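(* Assume $\mathbb E[\tanh(h)]=0$ and $\theta_1>\frac{1}{\mathbb E[\operatorname{sech}^2(h)]}$. Then the Low Temperature Test (described in the context, with a suitable choice of threshold $\tau_\delta$ in the stated intervals) is asymptotically powerful when 1. $k=o(\sqrt n)$ and $m\gtrsim\log\frac nk$ (i.e. $m\ge C\log\frac nk$ for a sufficiently large constant $C$); 2. $k\asymp n^{1/2}$ and $m=\omega(1)$; 3. $k=\omega(\sqrt n)$ and $m=1$.
   Context: Planted random field Curie-Weiss (pRFCW) model. Let $\mu$ be a probability measure on $\mathbb R$, $h\sim\mu$, $\theta_1>0$, $[n]=\{1,\dots,n\}$, and $h_1,\dots,h_n$ i.i.d. $\sim\mu$, $\boldsymbol h=(h_1,\dots,h_n)$. For $S\subset[n]$ with $|S|=k$ define, for $\boldsymbol\sigma\in\{-1,+1\}^n$, $$\mathbb P_S(\boldsymbol\sigma\mid\boldsymbol h)\propto\exp\Big(\frac{\theta_1}{2k}\sum_{i,j\in S}\sigma_i\sigma_j+\sum_{i=1}^n h_i\sigma_i\Big),\qquad \mathbb P_0(\boldsymbol\sigma\mid\boldsymbol h)\propto\exp\Big(\sum_{i=1}^n h_i\sigma_i\Big),$$ each normalized, and $\mathbb P_S(\boldsymbol\sigma)=\mathbb E_{\boldsymbol h}[\mathbb P_S(\boldsymbol\sigma\mid\boldsymbol h)]$, $\mathbb P_0(\boldsymbol\sigma)=\mathbb E_{\boldsymbol h}[\mathbb P_0(\boldsymbol\sigma\mid\boldsymbol h)]$. One observes $m$ i.i.d. samples $\boldsymbol\sigma^{(1)},\dots,\boldsymbol\sigma^{(m)}$;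 $\mathbb P_{0,m}$, $\mathbb P_{S,m}$ are the $m$-fold products of $\mathbb P_0$, $\mathbb P_S$. Asymptotics: $k\to\infty$ with $n=n(k)\ge k$, $m=m(k)\ge1$; $\mu,\theta_1$ fixed. A sequence of tests $\psi$ ($\psi=1$ means reject the null) is asymptotically powerful if $$\lim_{k\to\infty}\Big[\mathbb P_{0,m}(\psi=1)+\sup_{S:|S|=k}\mathbb P_{S,m}(\psi=0)\Big]=0.$$ $a=\omega(b)$ means $b=o(a)$. Low Temperature Test. Let $x$ be the positive solution of $x=\mathbb E[\tanh(\theta_1x+h)]$ and $\Phi$ the standard Gaussian cumulative distribution function. - If $k=o(\sqrt n)$: for each $S\subset[n]$, $|S|=k$, compute $\phi_S=\frac1m\sum_{j=1}^m\left|\frac1k\sum_{i\in S}\sigma_i^{(j)}\right|$ and reject the null if $\phi_3=\sup_{S:|S|=k}\phi_S\ge\tau_\delta$, with $\tau_\delta\in(0,x)$. - Otherwise compute $\phi_4=\frac1m\sum_{j=1}^m\left|\frac1k\sum_{i=1}^n\sigma_i^{(j)}\right|$. If $k\asymp\sqrt n$, reject the null if $\phi_4>\tau_\delta$ with $\tau_\delta\in\left(\sqrt{\frac{2n}{\pi k^2}},\ \frac{\sqrt n}{k}\sqrt{\frac2\pi}\exp\left(-\frac{x^2k^2}{2n}\right)+x\left[1-2\Phi\left(-\frac{xk}{\sqrt n}\right)\right]\right)$. If $k=\omega(\sqrt n)$, reject the null if $\phi_4>\tau_\delta$ with $\tau_\delta\in(0,x)$. *)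

(* Defs.v *)
From HB Require Import structures.
From mathcomp Require Import all_boot all_order all_algebra.
From mathcomp Require Import all_classical all_reals all_analysis.

Set Implicit Arguments.
Unset Strict Implicit.
Unset Printing Implicit Defensive.

Import Order.TTheory GRing.Theory Num.Theory.
Import numFieldNormedType.Exports.

Local Open Scope classical_set_scope.
Local Open Scope ring_scope.

Section Hyperbolic.
Context {R : realType}.
Implicit Types x : R.

Definition cosh x : R := (expR x + expR (- x)) / 2.
Definition sinh x : R := (expR x - expR (- x)) / 2.
Definition tanh x : R := sinh x / cosh x.
Definition sech x : R := (cosh x)^-1.

End Hyperbolic.

Definition Phi {R : realType} (z : R) : R := fine (normal_prob 0 1 `]-oo, z]).

Section ProductProbability.
Context d (T : measurableType d) (R : realType).

Definition cons_pair n (p : T * n.-tuple T) : n.+1.-tuple T :=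
  [tuple of p.1 :: p.2].

Let measurable_cons_pair n : measurable_fun setT (@cons_pair n).
Proof. exact: measurable_cons. Qed.

HB.instance Definition _ n :=
  isMeasurableFun.Build _ _ _ _ (@cons_pair n) (@measurable_cons_pair n).

(* The n-fold product [mu (x) ... (x) mu], i.e. the joint law of n i.i.d.
   variables of law [mu]. *)
Fixpoint iid_law (mu : probability T R) n : probability (n.-tuple T) R :=
  if n is n'.+1
  then distribution (mu \x iid_law mu n')%E (@cons_pair n')
  else \d_[tuple].

Lemma iid_law_box (mu : probability T R) n (A : 'I_n -> set T) :
  (forall i, measurable (A i)) ->
  iid_law mu n [set h | forall i, A i (tnth h i)] = (\prod_(i < n) mu (A i))%E.
Proof.
elim: n A => [|n IHn] A mA /=.
  by rewrite big_ord0 diracE mem_set// => -[].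
rewrite /distribution /pushforward.
set B := [set h : n.-tuple T | forall i, A (lift ord0 i) (tnth h i)].
have mB : measurable B.
  rewrite (_ : B = \bigcap_(i in [set: 'I_n])
      ((@tnth n T)^~ i @^-1` A (lift ord0 i))).
    apply: fin_bigcap_measurable => // i _.
    rewrite -[X in measurable X]setTI.
    exact: measurable_tnth.
  by apply/seteqP; split => h /= Bh; [move=> i _ | move=> i]; exact: Bh.
have -> : @cons_pair n @^-1` [set h | forall i, A i (tnth h i)] =
          A ord0 `*` B.
  apply/seteqP; split => -[a t] /=.
    move=> At; split; first by have := At ord0.
    by move=> i; have := At (lift ord0 i); rewrite tnthS.
  case=> /= A0 Bt i; case: (unliftP ord0 i) => [j ->|->//].
  by rewrite tnthS; exact: Bt.
rewrite product_measure1E// big_ord_recl; congr (_ * _)%E.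
exact: (IHn (fun i => A (lift ord0 i))).
Qed.

End ProductProbability.

Section Model.
Context {R : realType}.

Definition config n := {ffun 'I_n -> bool}.

(* [true] encodes the spin +1 and [false] the spin -1. *)
Definition spin n (sigma : config n) (i : 'I_n) : R :=
  if sigma i then 1 else -1.

Definition gibbs n (H : config n -> R) (sigma : config n) : R :=
  expR (H sigma) / \sum_(tau : config n) expR (H tau).

Definition field_energy n (h : n.-tuple R) (sigma : config n) : R :=
  \sum_(i < n) tnth h i * spin sigma i.

Definition planted_energy (theta1 : R) n (S : {set 'I_n}) (h : n.-tuple R)
    (sigma : config n) : R :=
  theta1 / (2 * #|S|%:R) * (\sum_(i in S) \sum_(j in S) spin sigma i * spin sigma j)
  + field_energy h sigma.

Definition null_pmf (mu : probability (measurableTypeR R) R) n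
    (sigma : config n) : R :=
  \int[iid_law mu n]_h gibbs (field_energy h) sigma.

Definition planted_pmf (mu : probability (measurableTypeR R) R) (theta1 : R) n
    (S : {set 'I_n}) (sigma : config n) : R :=
  \int[iid_law mu n]_h gibbs (planted_energy theta1 S h) sigma.

Definition samples n m := m.-tuple (config n).

Definition prod_prob n m (p : config n -> R) (A : pred (samples n m)) : R :=
  \sum_(s : samples n m | A s) \prod_(j < m) p (tnth s j).

(* A test rejects the null hypothesis on [s] when [psi s = true].  The
   probabilities being nonnegative, starting the maximum at 0 is harmless. *)
Definition risk (mu : probability (measurableTypeR R) R) (theta1 : R)
    n m k (psi : pred (samples n m)) : R :=
  prod_prob (null_pmf mu (n := n)) psi +
  \big[Num.max/0]_(S : {set 'I_n} | #|S| == k)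
     prod_prob (planted_pmf mu theta1 S) (fun s => ~~ psi s).

Definition asymptotically_powerful (mu : probability (measurableTypeR R) R)
    (theta1 : R) (n m : nat -> nat)
    (psi : forall k, pred (samples (n k) (m k))) : Prop :=
  (fun k => risk mu theta1 k (psi k)) @ \oo --> (0 : R).

Section Tests.
Variables (n m k : nat).
Implicit Types (s : samples n m) (tau : R).

Definition phi_set (S : {set 'I_n}) s : R :=
  m%:R^-1 * \sum_(j < m) `|k%:R^-1 * \sum_(i in S) spin (tnth s j) i|.

Definition phi3 s : R :=
  \big[Num.max/0]_(S : {set 'I_n} | #|S| == k) phi_set S s.

Definition phi4 s : R :=
  m%:R^-1 * \sum_(j < m) `|k%:R^-1 * \sum_(i < n) spin (tnth s j) i|.

Definition scan_test tau : pred (samples n m) := fun s => tau <= phi3 s.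

Definition sum_test tau : pred (samples n m) := fun s => tau < phi4 s.

End Tests.

(* The endpoints of the interval for the threshold when [k] is of order
   [sqrt n]. *)
Definition tau_lower (n k : nat) : R :=
  Num.sqrt (2 * n%:R / (pi * k%:R ^+ 2)).

Definition tau_upper (x : R) (n k : nat) : R :=
  Num.sqrt n%:R / k%:R * Num.sqrt (2 / pi)
    * expR (- (x ^+ 2 * k%:R ^+ 2) / (2 * n%:R))
  + x * (1 - 2 * Phi (- (x * k%:R) / Num.sqrt n%:R)).

End Model.

Arguments scan_test {R} n m k tau _.
Arguments sum_test {R} n m k tau _.

(* Main.v *)
Require Import Defs.
From mathcomp Require Import all_boot all_order all_algebra.
From mathcomp Require Import all_classical all_reals all_analysis.
From mathcomp Require Import measurable_realfun ring lra.
Import Order.TTheory GRing.Theory Num.Theory.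
Import numFieldNormedType.Exports.
Local Open Scope classical_set_scope.
Local Open Scope ring_scope.

(** The null law is uniform on the spin configurations, because integrating the
    field at a site makes its spin fair when [tanh h] has mean zero. For the same
    reason the planted law is invariant under flipping spins outside the planted
    set [S] ([planted_pmf_flip]), so that those spins are uniform and independent
    of the spins in [S]. Everything then rests on one fact about the spins in [S]:
    their average [T] is bounded away from zero, except with a probability
    exponentially small in [#|S|] ([planted_low_magnetization]).

    It follows from a comparison of the partition functions with and without the
    interaction. Given the field, a configuration with [`|T| <= eps] gains at most
    [theta * eps ^+ 2 / 2] per site from the interaction. Tilting the spins of [S]
    by a small [a] shows that the partition function gains about
    [a * tanh h + a ^+ 2 / 2 * (sech h ^+ 2 - theta^-1)] per site, whose mean is
    positive precisely in the low temperature regime. An exponential Chebyshev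
    inequality over the i.i.d. fields concludes.

    When there are several fixed points, [`|T|] may concentrate below [x]; this is
    harmless because the thresholds can be chosen small. When [k] is of order larger
    than [Num.sqrt n], the uniform spins (all of them under the null, those outside
    [S] under the planted law) contribute to the statistic with a vanishing second
    moment. When [k] is of smaller order, an exponential Chebyshev inequality and a
    union bound over the sets [S] control the null, and the planted set alone
    triggers the test.

    In the critical regime both means are of constant order and have to be
    compared. Write [W] for the contribution of all the spins, a rescaled simple
    random walk. Flipping the spins outside [S] turns the mean of the statistic
    into that of a maximum, which is at least the mean of [Num.max `|W| eps] up to
    small errors ([mean_abs_ge]). Wallis' product gives the mean of [`|W|] up to
    [k^-1] ([abs_walk_sqrt]), hence [tau_lower] is the right centring for the null;
    and since [`|S_n + S'_m|] has the mean of the maximum of the two independent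
    distances, the growth of the mean distance along the walk yields a definite
    gain of [Num.max `|W| eps] over [`|W|] ([walk_max_gain]). The threshold is placed half
    this gain above [tau_lower], or less if the interval given by folded normal
    means is shorter ([tau_upper_ge]); Chebyshev's inequality over the samples
    concludes. *)

Set Implicit Arguments.
Unset Strict Implicit.
Unset Printing Implicit Defensive.

(** * Integration against i.i.d. laws *)

Lemma integral_cst_probability d (T : measurableType d) (R : realType)
    (P : probability T R) (c : \bar R) : (\int[P]_x c = c)%E.
Proof.
rewrite integral_cst// -[RHS]mule1; congr (_ * _)%E; exact: probability_setT.
Qed.

Section IidLaw.
Context d (T : measurableType d) (R : realType) (mu : probability T R).

Lemma ge0_integral_iid_cons n (F : n.+1.-tuple T -> \bar R) :
  measurable_fun [set: n.+1.-tuple T] F -> (forall h, 0 <= F h)%E ->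
  (\int[iid_law mu n.+1]_h F h =
   \int[(mu \x iid_law mu n)%E]_p F (cons_pair p))%E.
Proof.
move=> mF F0; rewrite /= /distribution ge0_integral_pushforward//.
Qed.

Lemma measurable_cons_tail n (F : n.+1.-tuple T -> R) u :
  measurable_fun setT F -> measurable_fun setT (fun t => F (cons_pair (u, t))).
Proof.
move=> mF; have mcons : measurable_fun setT (@cons_pair _ T n).
  exact: measurable_cons.
exact: (measurableT_comp (measurableT_comp mF mcons) (pair1_measurable u)).
Qed.

(** One coordinate is independent of the others. Nonnegativity is what allows
    exchanging integrals without integrability assumptions; the coordinate is
    reached by peeling the tuple, so the induction is on its length. *)
Lemma ge0_integral_iid_coord n (F : n.-tuple T -> R) (f : T -> R) (i : 'I_n) :
  measurable_fun setT F -> (forall h, 0 <= F h) ->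
  measurable_fun setT f -> (forall u, 0 <= f u) ->
  (forall h h', (forall j, j != i -> tnth h j = tnth h' j) -> F h = F h') ->
  (\int[iid_law mu n]_h (F h * f (tnth h i))%:E =
   \int[iid_law mu n]_h (F h)%:E * \int[mu]_u (f u)%:E)%E.
Proof.
elim: n F i => [F [] //|n IHn] F i mF F0 mf f0 Fi.
have If0 : (0 <= \int[mu]_u (f u)%:E)%E.
  by apply: integral_ge0 => u _; rewrite lee_fin.
have mcons : measurable_fun setT (@cons_pair _ T n) by exact: measurable_cons.
have mG : measurable_fun setT (fun h : n.+1.-tuple T => F h * f (tnth h i)).
  apply: measurable_funM => //; apply: measurableT_comp => //.
  exact: measurable_tnth.
rewrite (ge0_integral_iid_cons (F := fun h => (F h * f (tnth h i))%:E));
  [|exact/measurable_EFinP|by move=> h; rewrite lee_fin mulr_ge0].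
rewrite (ge0_integral_iid_cons (F := fun h => (F h)%:E));
  [|exact/measurable_EFinP|by move=> h; rewrite lee_fin].
have mF' : measurable_fun setT (fun p : T * n.-tuple T => (F (cons_pair p))%:E).
  by apply/measurable_EFinP; exact: measurableT_comp.
have mG' : measurable_fun setT (fun p : T * n.-tuple T =>
    (F (cons_pair p) * f (tnth (cons_pair p) i))%:E).
  by apply/measurable_EFinP; exact: (measurableT_comp mG mcons).
have G0 p : (0 <= (F (cons_pair p) * f (tnth (cons_pair p) i))%:E)%E.
  by rewrite lee_fin mulr_ge0.
have F0' p : (0 <= (F (cons_pair p))%:E)%E by rewrite lee_fin.
case: (unliftP ord0 i) => [j ij|i0].
  rewrite !fubini_tonelli1//; rewrite -ge0_integralZr//; last 2 first.
  - exact: measurable_fun_fubini_tonelli_F.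
  - by move=> u _; apply: integral_ge0.
  apply: eq_integral => u _; rewrite /fubini_F.
  rewrite -(IHn (fun t => F (cons_pair (u, t))) j)//.
  - by apply: eq_integral => t _; rewrite ij tnthS.
  - exact: measurable_cons_tail.
  - move=> t t' tt'; apply: Fi => l; rewrite ij.
    case: (unliftP ord0 l) => [l' ->|->] //.
    by rewrite !tnthS (inj_eq lift_inj); exact: tt'.
rewrite !fubini_tonelli2//; rewrite -ge0_integralZr//; last 2 first.
- exact: measurable_fun_fubini_tonelli_G.
- by move=> u _; apply: integral_ge0.
apply: eq_integral => t _; rewrite /fubini_G.
have Ft u : F (cons_pair (u, t)) = F (cons_pair (point, t)).
  by apply: Fi => l; rewrite i0; case: (unliftP ord0 l) => [l' ->|->] //; rewrite !tnthS.
transitivity (\int[mu]_u ((F (cons_pair (point, t)))%:E * (f u)%:E))%E.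
  by apply: eq_integral => u _; rewrite Ft i0 EFinM.
transitivity (\int[mu]_u (F (cons_pair (point, t)))%:E * \int[mu]_u (f u)%:E)%E.
  rewrite ge0_integralZl ?lee_fin//; last by move=> u _; rewrite lee_fin.
    by rewrite integral_cst_probability.
  exact/measurable_EFinP.
by congr (_ * _)%E; apply: eq_integral => u _; rewrite Ft.
Qed.

Lemma ge0_integral_iid_prod n (f : 'I_n -> T -> R) :
  (forall i, measurable_fun setT (f i)) -> (forall i u, 0 <= f i u) ->
  (\int[iid_law mu n]_h (\prod_(i < n) f i (tnth h i))%:E =
   \prod_(i < n) \int[mu]_u (f i u)%:E)%E.
Proof.
elim: n f => [|n IHn] f mf f0.
  rewrite big_ord0; under eq_integral do rewrite big_ord0.
  exact: integral_cst_probability.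
have mP : measurable_fun setT
    (fun h : n.+1.-tuple T => \prod_(i < n.+1) f i (tnth h i)).
  apply: measurable_prod => i _; apply: (measurableT_comp (mf i)).
  exact: measurable_tnth.
have mcons : measurable_fun setT (@cons_pair _ T n) by exact: measurable_cons.
rewrite ge0_integral_iid_cons; first last.
- by move=> h; rewrite lee_fin prodr_ge0.
- exact/measurable_EFinP.
rewrite fubini_tonelli1; first last.
- by move=> p; rewrite lee_fin prodr_ge0.
- by apply/measurable_EFinP; exact: (measurableT_comp mP mcons).
rewrite big_ord_recl -(IHn (fun i => f (lift ord0 i)))//.
rewrite -ge0_integralZr//; first last.
- by apply: integral_ge0 => u _; rewrite lee_fin prodr_ge0.
- by move=> u _; rewrite lee_fin.
- exact/measurable_EFinP.
apply: eq_integral => u _; rewrite /fubini_F.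
transitivity (\int[iid_law mu n]_t
    ((f ord0 u)%:E * (\prod_(i < n) f (lift ord0 i) (tnth t i))%:E))%E.
  apply: eq_integral => t _; rewrite -EFinM big_ord_recl; congr (_ * _)%:E.
  by apply: eq_bigr => i _; rewrite tnthS.
rewrite ge0_integralZl ?lee_fin//.
- apply/measurable_EFinP; apply: measurable_prod => i _.
  by apply: (measurableT_comp (mf (lift ord0 i))); exact: measurable_tnth.
- by move=> t _; rewrite lee_fin prodr_ge0.
Qed.

End IidLaw.

Section Expectation.
Context d (T : measurableType d) (R : realType) (P : probability T R).
Implicit Types f g : T -> R.

Lemma bounded_integrable f (M : R) :
  measurable_fun setT f -> (forall x, `|f x| <= M) ->
  P.-integrable setT (EFin \o f).
Proof.
move=> mf fM; apply: measurable_bounded_integrable => //.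
  by rewrite (le_lt_trans (probability_le1 P measurableT)) ?ltry.
exists M; split; first exact: num_real.
by move=> y My x _ /=; rewrite (le_trans (fM x)) ?ltW.
Qed.

Lemma Rintegral_cst_probability (c : R) : \int[P]_x c = c.
Proof. by rewrite /Rintegral integral_cst_probability. Qed.

(** Integrability and the equality are proved together, each step of the induction
    on the sequence needing both for the tail. *)
Lemma Rintegral_sum (I : Type) (r : seq I) (Q : pred I) (F : I -> T -> R) :
  (forall i, P.-integrable setT (EFin \o F i)) ->
  P.-integrable setT (EFin \o (fun x => \sum_(i <- r | Q i) F i x)) /\
  \int[P]_x (\sum_(i <- r | Q i) F i x) = \sum_(i <- r | Q i) \int[P]_x F i x.
Proof.
move=> iF; elim: r => [|i r [Ir IHr]].
  rewrite (_ : (fun x => _) = cst 0); last first.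
    by apply/funext => x; rewrite big_nil.
  rewrite big_nil; split; last exact: Rintegral_cst_probability.
  by apply: (@bounded_integrable _ 0) => // x; rewrite normr0.
rewrite big_cons; case: ifP => Qi; last first.
  rewrite (_ : (fun x => _) = fun x => \sum_(j <- r | Q j) F j x)//.
  by apply/funext => x; rewrite big_cons Qi.
rewrite (_ : (fun x => _) = fun x => F i x + \sum_(j <- r | Q j) F j x).
  split; first exact: (integrableD measurableT (iF i) Ir).
  by rewrite RintegralD// IHr.
by apply/funext => x; rewrite big_cons Qi.
Qed.

End Expectation.

(** * Gibbs measures and spin flips *)

Section Gibbs.
Context {R : realType} (n : nat).
Implicit Types (H : config n -> R) (sigma tau : config n).

Lemma partition_gt0 H : 0 < \sum_(tau : config n) expR (H tau).
Proof.
rewrite (bigD1 [ffun=> true])//= ltr_pwDl ?expR_gt0//.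
by apply: sumr_ge0 => tau _; exact: expR_ge0.
Qed.

Lemma gibbs_ge0 H sigma : 0 <= gibbs H sigma.
Proof. by rewrite divr_ge0 ?expR_ge0// ltW// partition_gt0. Qed.

Lemma sum_gibbs H : \sum_sigma gibbs H sigma = 1.
Proof. by rewrite -mulr_suml divff// gt_eqF// partition_gt0. Qed.

Lemma gibbs_le1 H sigma : gibbs H sigma <= 1.
Proof.
rewrite -(sum_gibbs H) (bigD1 sigma)//= lerDl.
by apply: sumr_ge0 => tau _; exact: gibbs_ge0.
Qed.

Lemma measurable_gibbs d (T : measurableType d) (H : T -> config n -> R) sigma :
  (forall tau, measurable_fun setT (H ^~ tau)) ->
  measurable_fun setT (fun h => gibbs (H h) sigma).
Proof.
move=> mH.
(* The quotient is an exponential, the partition function being positive. *)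
rewrite (_ : (fun h => _) =
    fun h => expR (H h sigma - ln (\sum_tau expR (H h tau)))); last first.
  by apply/funext => h; rewrite expRD expRN lnK// posrE partition_gt0.
apply: measurableT_comp => //; apply: measurable_funB => //.
apply: measurableT_comp => //.
by apply: measurable_sum => tau; exact: measurableT_comp.
Qed.

(** Spins are flipped by adding a configuration modulo two: this makes the
    flips an involutive, commutative family indexed by the configurations. *)
Definition flip (rho sigma : config n) : config n :=
  [ffun i => rho i (+) sigma i].

Lemma flipK rho : involutive (flip rho).
Proof. by move=> sigma; apply/ffunP => i; rewrite !ffunE addKb. Qed.

Lemma flipC rho sigma : flip rho sigma = flip sigma rho.
Proof. by apply/ffunP => i; rewrite !ffunE addbC. Qed.

Lemma spin_flip rho sigma i :
  spin (flip rho sigma) i = (-1) ^+ rho i * spin sigma i :> R.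
Proof.
by rewrite /spin !ffunE; case: (rho i); case: (sigma i) => /=;
  rewrite ?expr1 ?expr0 ?mul1r ?mulrN1 ?mulN1r ?opprK.
Qed.

Definition flip1 (i : 'I_n) : config n := [ffun j => j == i].

Lemma spin_pm1 sigma i : spin sigma i = 1 :> R \/ spin sigma i = -1 :> R.
Proof. by rewrite /spin; case: (sigma i); [left|right]. Qed.

Lemma expR_spin sigma i (u : R) :
  expR (u * spin sigma i) / cosh u = 1 + spin sigma i * tanh u.
Proof.
have c0 : cosh u != 0 by rewrite gt_eqF// divr_gt0// addr_gt0// expR_gt0.
apply: (mulIf c0); rewrite divfK// mulrDl mul1r -mulrA divfK// /cosh /sinh.
by case: (spin_pm1 sigma i) => ->; rewrite ?mulr1 ?mulrN1; field.
Qed.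

(** Summing the weights over the two values of the spin at [i] turns the field
    acting on that spin into the factor [cosh u] of the partition function. *)
Lemma gibbs_field H i (u : R) sigma :
  (forall tau, H (flip (flip1 i) tau) = H tau) ->
  gibbs (fun tau => H tau + u * spin tau i) sigma =
  gibbs H sigma * (1 + spin sigma i * tanh u).
Proof.
move=> Hi; rewrite -expR_spin /gibbs expRD mulf_div; congr (_ / _).
set Z := LHS; have ZE : Z = \sum_tau expR (H tau) * expR (- (u * spin tau i)).
  rewrite /Z (reindex_inj (inv_inj (flipK (flip1 i)))) /=.
  apply: eq_bigr => tau _; rewrite Hi spin_flip ffunE eqxx expr1 -expRD.
  by congr expR; ring.
apply: (@mulfI _ 2); rewrite ?pnatr_eq0// mulr2n mulrDl !mul1r {1}ZE.
rewrite /Z -big_split/= mulrC -mulrA mulr_suml; apply: eq_bigr => tau _.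
rewrite expRD /cosh divfK ?pnatr_eq0// -mulrDr; congr (_ * _).
by case: (spin_pm1 tau i) => ->; rewrite ?mulr1 ?mulrN1 ?opprK//; exact: addrC.
Qed.

End Gibbs.

Section Tanh.
Context {R : realType}.

Lemma cosh_gt0 (u : R) : 0 < cosh u.
Proof. by rewrite divr_gt0// addr_gt0// expR_gt0. Qed.

Lemma tanh_bound (u : R) : `|tanh u| < 1.
Proof.
rewrite /tanh normrM normrV ?unitfE ?gt_eqF ?cosh_gt0//.
rewrite ltr_pdivrMr ?mul1r ?normr_gt0 ?gt_eqF ?cosh_gt0//.
rewrite (gtr0_norm (cosh_gt0 u)) /sinh /cosh ltr_norml.
have := expR_gt0 u; have := expR_gt0 (- u); lra.
Qed.

Lemma measurable_tanh : measurable_fun setT (@tanh R).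
Proof.
have me : measurable_fun setT (fun u : R => expR (- u)).
  by apply: measurableT_comp => //; exact: measurable_funN.
have mc : measurable_fun setT (@cosh R).
  by apply: measurable_funM => //; exact: measurable_funD.
rewrite (_ : tanh = fun u => sinh u * expR (- ln (cosh u))); last first.
  by apply/funext => u; rewrite expRN lnK// posrE cosh_gt0.
apply: measurable_funM.
  by apply: measurable_funM => //; exact: measurable_funB.
apply: measurableT_comp => //; apply: measurableT_comp => //.
exact: measurableT_comp.
Qed.

End Tanh.

(** * The planted law *)

Section PlantedLaw.
Context {R : realType} (mu : probability (measurableTypeR R) R) (theta : R).

Lemma integrable_tanh : mu.-integrable setT (EFin \o @tanh R).
Proof.
apply: (@bounded_integrable _ _ _ mu _ 1) => [|u]; first exact: measurable_tanh.
exact/ltW/tanh_bound.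
Qed.

Lemma measurable_tnth_real n (i : 'I_n) :
  measurable_fun setT (fun h : n.-tuple (measurableTypeR R) => tnth h i : R).
Proof. exact: measurable_tnth. Qed.

Lemma measurable_planted_energy n (S : {set 'I_n}) (sigma : config n) :
  measurable_fun setT (fun h : n.-tuple (measurableTypeR R) =>
    planted_energy theta S h sigma).
Proof.
apply: measurable_funD => //; apply: measurable_sum => i.
by apply: measurable_funM => //; exact: measurable_tnth_real.
Qed.

Lemma integrable_planted_gibbs n (S : {set 'I_n}) (sigma : config n) :
  (iid_law mu n).-integrable setT
    (EFin \o (fun h => gibbs (planted_energy theta S h) sigma)).
Proof.
apply: (@bounded_integrable _ _ _ _ _ 1) => [|h].
  by apply: measurable_gibbs => tau; exact: measurable_planted_energy.
by rewrite ger0_norm ?gibbs_ge0// gibbs_le1.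
Qed.

Lemma planted_pmf_ge0 n (S : {set 'I_n}) (sigma : config n) :
  0 <= planted_pmf mu theta S sigma.
Proof. by apply: Rintegral_ge0 => h _; exact: gibbs_ge0. Qed.

Lemma sum_planted_pmf n (S : {set 'I_n}) :
  \sum_(sigma : config n) planted_pmf mu theta S sigma = 1.
Proof.
have [_ <-] := Rintegral_sum (index_enum (config n)) predT
  (@integrable_planted_gibbs n S).
rewrite -[RHS](Rintegral_cst_probability (iid_law mu n)).
by apply: eq_Rintegral => h _; exact: sum_gibbs.
Qed.

(** With no planted site the interaction disappears, so that facts on the planted
    law specialize to the null law. *)
Lemma null_pmf_planted n : @null_pmf R mu n = planted_pmf mu theta finset.set0.
Proof.
apply/funext => sigma.
have energyE h : field_energy h = planted_energy theta finset.set0 h :> (config n -> R).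
  apply/funext => tau.
  by rewrite /planted_energy big_set0 mulr0 add0r.
rewrite /null_pmf; under eq_Rintegral do rewrite energyE.
by [].
Qed.

Hypothesis mean_tanh : \int[mu]_h tanh h = 0.

(** The field at a site [i] outside [S] enters the planted law only through the
    factor [1 + spin sigma i * tanh (h i)], which has mean one and is independent
    of the other fields. *)
Lemma planted_pmf_flip1 n (S : {set 'I_n}) (i : 'I_n) (sigma : config n) :
  i \notin S ->
  planted_pmf mu theta S (flip (flip1 i) sigma) = planted_pmf mu theta S sigma.
Proof.
move=> iS.
(* Without the field at [i], the energy is invariant under the flip. *)
pose H (h : n.-tuple R) (tau : config n) :=
  planted_energy theta S h tau - tnth h i * spin tau i.
have mH tau : measurable_fun setT
    (fun h : n.-tuple (measurableTypeR R) => H h tau).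
  apply: measurable_funB; first exact: measurable_planted_energy.
  by apply: measurable_funM => //; exact: measurable_tnth_real.
have HE h tau : H h tau = theta / (2 * #|S|%:R) *
    (\sum_(j in S) \sum_(l in S) spin tau j * spin tau l) +
    \sum_(j < n | j != i) tnth h j * spin tau j.
  rewrite /H /planted_energy /field_energy -addrA; congr (_ + _).
  by rewrite (bigD1 i)//= addrAC subrr add0r.
have flip_ne tau j : j != i -> spin (flip (flip1 i) tau) j = spin tau j :> R.
  by move=> /negbTE ji; rewrite spin_flip ffunE ji mul1r.
have Sne j : j \in S -> j != i by apply: contraTneq => ->.
have Hflip h tau : H h (flip (flip1 i) tau) = H h tau.
  rewrite !HE; congr (_ * _ + _).
    apply: eq_bigr => j jS; apply: eq_bigr => l lS.
    by rewrite !flip_ne ?Sne.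
  by apply: eq_bigr => j ji; rewrite flip_ne.
suff key tau : planted_pmf mu theta S tau =
    fine (\int[iid_law mu n]_h (gibbs (H h) tau)%:E)%E.
  rewrite !key; congr fine; apply: eq_integral => h _.
  congr (_ %:E); rewrite /gibbs Hflip//.
have gibbsE h : gibbs (planted_energy theta S h) tau =
    gibbs (H h) tau * (1 + spin tau i * tanh (tnth h i)).
  have EH : planted_energy theta S h = fun t => H h t + tnth h i * spin t i.
    by apply/funext => t; rewrite addrNK.
  by rewrite EH gibbs_field//; exact: Hflip.
rewrite /planted_pmf /Rintegral; congr fine.
under eq_integral do rewrite gibbsE.
have mf : measurable_fun setT (fun u : measurableTypeR R => 1 + spin tau i * tanh u).
  apply: measurable_funD => //; apply: measurable_funM => //.
  exact: measurable_tanh.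
rewrite (ge0_integral_iid_coord mu (F := fun h => gibbs (H h) tau)
  (f := fun u => 1 + spin tau i * tanh u))//.
- rewrite -[RHS]mule1; congr (_ * _)%E.
  have it : mu.-integrable setT (EFin \o (fun u : measurableTypeR R => spin tau i * tanh u)).
    exact: (integrableZl measurableT (spin tau i) integrable_tanh).
  have i1 : mu.-integrable setT (EFin \o (fun u : measurableTypeR R => 1)).
    by apply: (@bounded_integrable _ _ _ mu _ 1) => // u; rewrite normr1.
  have : \int[mu]_u (1 + spin tau i * tanh u) = 1.
    by rewrite RintegralD// Rintegral_cst_probability RintegralZl// ?mean_tanh
      ?mulr0 ?addr0//; exact: integrable_tanh.
  move=> e1; rewrite -[LHS]fineK; first exact: (congr1 EFin e1).
  exact: (integrable_fin_num measurableT (integrableD measurableT i1 it)).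
- by apply: measurable_gibbs => t; exact: mH.
- by move=> h; exact: gibbs_ge0.
- move=> u; have := tanh_bound u; rewrite ltr_norml => /andP[u1 u2].
  by case: (spin_pm1 (R:=R) tau i) => ->; lra.
- move=> h h' hh'; rewrite /gibbs; congr (_ / _).
    congr expR; rewrite !HE; congr (_ + _); apply: eq_bigr => j ji.
    by rewrite hh'.
  apply: eq_bigr => t _; congr expR; rewrite !HE; congr (_ + _).
  by apply: eq_bigr => j ji; rewrite hh'.
Qed.

Lemma planted_pmf_flip n (S : {set 'I_n}) (rho sigma : config n) :
  (forall i, i \in S -> rho i = false) ->
  planted_pmf mu theta S (flip rho sigma) = planted_pmf mu theta S sigma.
Proof.
move: {2}#|_| (leqnn #|[set i | rho i]%SET|) => m.
elim: m rho sigma => [|m IHm] rho sigma.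
  rewrite leqn0 cards_eq0 => /eqP r0 _; congr planted_pmf.
  apply/ffunP => i; rewrite ffunE; have : i \notin [set i | rho i]%SET.
    by rewrite r0 inE.
  by rewrite inE => /negbTE ->.
move=> rm rS; have [r0|[i]] := set_0Vmem [set i | rho i]%SET.
  by apply: IHm => //; rewrite r0 cards0.
rewrite inE => ri.
have iS : i \notin S by apply/negP => /rS; rewrite ri.
have -> : flip rho sigma = flip (flip1 i) (flip (flip (flip1 i) rho) sigma).
  by apply/ffunP => j; rewrite !ffunE; case: eqP => //= _; rewrite ?negbK; case: (rho j); case: (sigma j).
rewrite planted_pmf_flip1//; apply: IHm => [|j jS].
  rewrite -ltnS; apply: leq_trans rm; apply: proper_card; apply/properP; split.
    apply/fintype.subsetP => j; rewrite !inE !ffunE; case: eqP => [->|//].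
    by rewrite ri.
  by exists i; rewrite inE// !ffunE eqxx ri.
by rewrite !ffunE rS// addbF; apply/negbTE; apply: contraNneq iS => <-.
Qed.

Definition uniform_mean n (f : config n -> R) : R :=
  2 ^- n * \sum_(sigma : config n) f sigma.

Lemma card_config n : #|{: config n}| = (2 ^ n)%N.
Proof. by rewrite card_ffun card_bool card_ord. Qed.

(** Averaging over all the flips of the spins outside [S] turns the planted mean
    into a uniform one. *)
Lemma planted_mean_outside n (S : {set 'I_n}) (f : config n -> R) :
  (forall sigma tau : config n, (forall i, i \notin S -> sigma i = tau i) ->
    f sigma = f tau) ->
  \sum_sigma planted_pmf mu theta S sigma * f sigma = uniform_mean f.
Proof.
move=> fS; pose mask (rho : config n) : config n :=
  [ffun i => rho i && (i \notin S)].
have E rho : \sum_sigma planted_pmf mu theta S sigma * f sigma =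
    \sum_sigma planted_pmf mu theta S sigma * f (flip rho sigma).
  rewrite (reindex_inj (inv_inj (flipK (mask rho)))) /=.
  apply: eq_bigr => sigma _; rewrite planted_pmf_flip; last first.
    by move=> i iS; rewrite ffunE iS andbF.
  congr (_ * _); apply: fS => i iS; rewrite !ffunE iS andbT//.
apply: (@mulfI _ (2 ^+ n)); first by rewrite expf_neq0// pnatr_eq0.
rewrite /uniform_mean mulrA divff ?expf_neq0 ?pnatr_eq0// mul1r.
transitivity (\sum_(rho : config n)
    \sum_sigma planted_pmf mu theta S sigma * f (flip rho sigma)).
  under [RHS]eq_bigr do rewrite -E.
  by rewrite sumr_const card_config -natrX mulr_natl.
rewrite exchange_big/= -[RHS]mul1r -(sum_planted_pmf S) mulr_suml.
apply: eq_bigr => sigma _; rewrite -mulr_sumr; congr (_ * _).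
rewrite [RHS](reindex_inj (inv_inj (flipK sigma))) /=.
by apply: eq_bigr => rho _; rewrite flipC.
Qed.

Lemma null_mean n (f : config n -> R) :
  \sum_sigma null_pmf mu sigma * f sigma = uniform_mean f.
Proof.
rewrite null_pmf_planted; apply: planted_mean_outside => sigma tau st.
by congr f; apply/ffunP => i; apply: st; rewrite inE.
Qed.

End PlantedLaw.

(** * Elementary inequalities *)

Section RealInequalities.
Context {R : realType}.
Implicit Types x y z a b t u : R.

Lemma is_derive_ge0_le (f df : R -> R) a b :
  (forall x, is_derive x 1 f (df x)) -> (forall x, a < x < b -> 0 <= df x) ->
  a <= b -> f a <= f b.
Proof.
move=> fdf df0; rewrite le_eqVlt => /predU1P[->//|ab].
have cf : {within `[a, b], continuous f}.
  apply: continuous_subspaceT => x; apply: differentiable_continuous.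
  by apply/derivable1_diffP; case: (fdf x).
have [c cab fc] := MVT ab (fun x _ => fdf x) cf.
rewrite -subr_ge0 fc mulr_ge0 ?df0 ?subr_ge0 ?ltW//.
Qed.

Lemma expR_le_cubic_ge0 z : 0 <= z <= 2^-1 ->
  expR z <= 1 + z + z ^+ 2 / 2 + z ^+ 3.
Proof.
have lin x : 0 <= x <= 2^-1 -> expR x <= 1 + 2 * x.
  move=> /andP[x0 x1]; have := expR_ge1Dx (- x); have := expRxMexpNx_1 x.
  have := expR_gt0 x; have := expR_gt0 (- x); nra.
have quad x : 0 <= x <= 2^-1 -> expR x <= 1 + x + x ^+ 2.
  move=> /andP[x0 x1]; pose f y : R := 1 + y + y ^+ 2 - expR y.
  have df y : is_derive y 1 f (1 + 2 * y - expR y).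
    by apply: is_derive_eq; rewrite /= !scaler1; ring.
  have := is_derive_ge0_le df _ x0; rewrite {1 2}/f expR0 expr0n /= => H.
  rewrite -subr_ge0; apply: le_trans (H _); first by lra.
  move=> y /andP[y0 y1]; rewrite subr_ge0 lin//; lra.
move=> /andP[z0 z1].
pose f y : R := 1 + y + y ^+ 2 / 2 + y ^+ 3 - expR y.
have df y : is_derive y 1 f (1 + y + 3 * y ^+ 2 - expR y).
  by apply: is_derive_eq; rewrite /GRing.scale /=; field.
have := is_derive_ge0_le df _ z0; rewrite {1 2}/f expR0 => H.
rewrite -subr_ge0; apply: le_trans (H _); first by lra.
move=> y /andP[y0 y1]; have y2 := sqr_ge0 y.
have : expR y <= 1 + y + y ^+ 2 by apply: quad; lra.
lra.
Qed.

Lemma expR_ge_quadratic z : 0 <= z -> 1 + z + z ^+ 2 / 2 <= expR z.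
Proof.
move=> z0; pose f y : R := expR y - (1 + y + y ^+ 2 / 2).
have df y : is_derive y 1 f (expR y - (1 + y)).
  by apply: is_derive_eq; rewrite /GRing.scale /=; field.
have := is_derive_ge0_le df _ z0; rewrite {1 2}/f expR0 => H.
rewrite -subr_ge0; apply: le_trans (H _); first by lra.
by move=> y _; rewrite subr_ge0 expR_ge1Dx.
Qed.

Lemma expRN_le_quadratic z : 0 <= z -> expR (- z) <= 1 - z + z ^+ 2 / 2.
Proof.
move=> z0; have := expR_ge_quadratic z0; have := expRxMexpNx_1 z.
have := expR_gt0 (- z); have := expR_gt0 z; set u := expR z; set v := expR (- z).
move=> u0 v0 uv uz; have z4 : 0 <= (z ^+ 2) ^+ 2 := sqr_ge0 _.
rewrite -(ler_pM2l u0) uv.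
have p0 : 0 <= 1 - z + z ^+ 2 / 2 by have := sqr_ge0 (1 - z); nra.
apply: le_trans (ler_wpM2r p0 uz); nra.
Qed.

Lemma expR_le_cubic z : `|z| <= 2^-1 ->
  expR z <= 1 + z + z ^+ 2 / 2 + `|z| ^+ 3.
Proof.
move=> zl; have [z0|z0] := leP 0 z.
  by rewrite ger0_norm// expR_le_cubic_ge0// z0 -[leLHS]ger0_norm.
rewrite -[in leLHS](opprK z); have nz0 : 0 <= - z by rewrite oppr_ge0 ltW.
have := expRN_le_quadratic nz0; have : 0 <= `|z| ^+ 3 by rewrite exprn_ge0.
rewrite sqrrN opprK; lra.
Qed.

Lemma expRN_ge_cubic z : 0 <= z <= 2^-1 ->
  1 - z + z ^+ 2 / 2 - z ^+ 3 <= expR (- z).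
Proof.
move=> z01; have := expR_le_cubic_ge0 z01; case/andP: z01 => z0 z1.
have := expRxMexpNx_1 z.
have := expR_gt0 (- z); have := expR_gt0 z; set u := expR z; set v := expR (- z).
move=> u0 v0 uv uz.
rewrite -(ler_pM2l u0) uv.
have p0 : 0 <= 1 - z + z ^+ 2 / 2 - z ^+ 3 by nra.
apply: le_trans (ler_wpM2r p0 uz) _.
rewrite (_ : _ * _ = 1 - (z ^+ 2) ^+ 2 * (7 / 4 + z ^+ 2)); last by field.
rewrite gerBl mulr_ge0 ?sqr_ge0 ?addr_ge0 ?sqr_ge0//; lra.
Qed.

Lemma cosh_ratio u a :
  cosh (u + a) / cosh u =
  ((1 + tanh u) * expR a + (1 - tanh u) * expR (- a)) / 2.
Proof.
have c0 : cosh u != 0 by rewrite gt_eqF// cosh_gt0.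
have e0 : expR u + expR (- u) != 0.
  by rewrite gt_eqF// addr_gt0// expR_gt0.
rewrite /tanh /sinh /cosh opprD !expRD; field; exact: e0.
Qed.

(** Second-order expansion of the log-moment generating function of a spin of
    mean [t]: its cumulants are [t] and [1 - t ^+ 2]. *)
Lemma expR_cumulants a t : 0 < a <= 22^-1 -> `|t| <= 1 ->
  expR (a * t + a ^+ 2 / 2 * (1 - t ^+ 2) - 11 * a ^+ 3) <=
  ((1 + t) * expR a + (1 - t) * expR (- a)) / 2.
Proof.
move=> /andP[a0 a1]; rewrite ler_norml => /andP[t1 t2].
(* The exponent is [a * t + r] with [r] of order [a ^+ 2]; expanding both sides,
   the terms of order two agree and [11 * a ^+ 3] absorbs the others. *)
set r := a ^+ 2 / 2 * (1 - t ^+ 2) - 11 * a ^+ 3.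
have a20 : 0 < a ^+ 2 by rewrite exprn_gt0.
have a30 : 0 < a ^+ 3 by rewrite exprn_gt0.
have a32 : a ^+ 3 <= a ^+ 2 / 22 by rewrite exprSr ler_pM2l.
have a2 : a ^+ 2 <= a / 22 by rewrite expr2 ler_pM2l.
have t20 := sqr_ge0 t.
have t21 : t ^+ 2 <= 1 by nra.
have rl : - (a ^+ 2) <= r by rewrite /r; nra.
have ru : r <= a ^+ 2 by rewrite /r; nra.
have q2 : `|a * t + r| <= 2 * a by rewrite ler_norml; apply/andP; split; nra.
rewrite -addrA -/r.
have : expR (a * t + r) <= 1 + (a * t + r) + (a * t + r) ^+ 2 / 2 + (2 * a) ^+ 3.
  apply: le_trans (expR_le_cubic _) _; first by rewrite (le_trans q2)//; lra.
  by rewrite lerD2l lerXn2r ?nnegrE// mulr_ge0// ltW.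
have rt : a * t * r <= a ^+ 3.
  have : `|a * t * r| <= a * a ^+ 2.
    rewrite normrM ler_pM// ?ler_norml ?rl ?ru//; apply/andP; split; nra.
  by rewrite -exprS => /(le_trans (ler_norm _)).
have r2 : r ^+ 2 <= a ^+ 3.
  rewrite -[r ^+ 2]ger0_norm ?sqr_ge0// normrX.
  have : `|r| <= a ^+ 2 by rewrite ler_norml rl ru.
  move=> /(lerXn2r 2 (normr_ge0 _) (sqr_ge0 _)) /le_trans; apply.
  rewrite (_ : (a ^+ 2) ^+ 2 = a ^+ 3 * a); last by ring.
  by rewrite ger_pMr//; lra.
have ea : 1 + a + a ^+ 2 / 2 <= expR a by apply: expR_ge_quadratic; exact: ltW.
have eNa : 1 - a + a ^+ 2 / 2 - a ^+ 3 <= expR (- a).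
  by apply: expRN_ge_cubic; rewrite ltW//=; lra.
have : (1 + t) * (1 + a + a ^+ 2 / 2) <= (1 + t) * expR a by rewrite ler_wpM2l//; lra.
have : (1 - t) * (1 - a + a ^+ 2 / 2 - a ^+ 3) <= (1 - t) * expR (- a) by rewrite ler_wpM2l//; lra.
have : 0 <= (1 + t) * a ^+ 3 by apply: mulr_ge0; [lra|exact: ltW].
have rE : r = a ^+ 2 / 2 * (1 - t ^+ 2) - 11 * a ^+ 3 by [].
have -> : (2 * a) ^+ 3 = 8 * a ^+ 3 by ring.
have -> : (a * t + r) ^+ 2 = a ^+ 2 * t ^+ 2 + 2 * (a * t * r) + r ^+ 2 by ring.
move: (expR (a * t + r)) (expR a) (expR (- a)) ea eNa => E Ea EN ? ?.
lra.
Qed.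

End RealInequalities.

(** * A low magnetization is unlikely under the planted law *)

Section Magnetization.
Context {R : realType} (n : nat).
Implicit Types (S : {set 'I_n}) (sigma tau : config n) (h : n.-tuple R).

Definition magnetization S sigma : R := \sum_(i in S) spin sigma i.

Lemma sum_spinM S sigma :
  \sum_(i in S) \sum_(j in S) spin sigma i * spin sigma j =
  magnetization S sigma ^+ 2 :> R.
Proof.
rewrite expr2 /magnetization mulr_suml; apply: eq_bigr => i _.
by rewrite mulr_sumr.
Qed.

Lemma sum_expR_field (u : 'I_n -> R) :
  \sum_sigma expR (\sum_i u i * spin sigma i) = \prod_i (2 * cosh (u i)).
Proof.
transitivity (\prod_(i < n) \sum_(b : bool) expR (u i * (if b then 1 else -1))).
  rewrite bigA_distr_bigA; apply: eq_bigr => sigma _.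
  by rewrite expR_sum; apply: eq_bigr => i _; rewrite /spin; case: (sigma i).
apply: eq_bigr => i _.
by rewrite big_bool /= mulr1 mulrN1 /cosh mulrC divfK// pnatr_eq0.
Qed.

(** Given the field, configurations of magnetization at most [eps * #|S|] gain at
    most [theta * eps ^+ 2 / 2] per site of [S] from the interaction, whereas
    tilting all the spins of [S] by [a] shows that the partition function gains
    [ln (cosh (h i + a) / cosh (h i)) - a ^+ 2 / (2 * theta)] per site. *)
Lemma gibbs_low_magnetization (theta a eps : R) S h : 0 < theta -> (0 < #|S|)%N ->
  \sum_(sigma | `|magnetization S sigma| <= eps * #|S|%:R)
     gibbs (planted_energy theta S h) sigma <=
  \prod_(i in S) (expR (a ^+ 2 / (2 * theta) + theta * eps ^+ 2 / 2) /
     (cosh (tnth h i + a) / cosh (tnth h i))).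
Proof.
move=> th0; rewrite -(ltr_nat R); set k : R := #|S|%:R => k0.
have k00 : k != 0 by rewrite gt_eqF.
have th00 : theta != 0 by rewrite gt_eqF.
set Z0 : R := \prod_i (2 * cosh (tnth h i)).
set Za : R := \prod_i (2 * cosh (tnth h i + if i \in S then a else 0)).
have Za0 : 0 < Za by apply: prodr_gt0 => i _; rewrite mulr_gt0// cosh_gt0.
have energyE sigma : planted_energy theta S h sigma =
    theta / (2 * k) * magnetization S sigma ^+ 2 + field_energy h sigma.
  by rewrite /planted_energy sum_spinM.
have low : \sum_(sigma | `|magnetization S sigma| <= eps * k)
    expR (planted_energy theta S h sigma) <=
    expR (k * (theta * eps ^+ 2 / 2)) * Z0.
  rewrite /Z0 -(sum_expR_field (fun i => tnth h i)) mulr_sumr [leRHS](bigID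
    (fun sigma => `|magnetization S sigma| <= eps * k))/=.
  rewrite ler_wpDr//; first by apply: sumr_ge0 => s _; rewrite mulr_ge0 ?expR_ge0.
  apply: ler_sum => sigma Ms; rewrite -expRD ler_expR energyE lerD2r.
  have : magnetization S sigma ^+ 2 <= (eps * k) ^+ 2.
    rewrite -[leLHS]ger0_norm ?sqr_ge0// normrX lerXn2r ?nnegrE//.
    exact: le_trans Ms.
  move=> /(ler_wpM2l (ltW (divr_gt0 th0 (mulr_gt0 (ltr0Sn R 1) k0)))) /le_trans.
  apply; rewrite le_eqVlt; apply/orP; left; apply/eqP; field; exact: k00.
have high : expR (- (k * (a ^+ 2 / (2 * theta)))) * Za <=
    \sum_sigma expR (planted_energy theta S h sigma).
  rewrite /Za -(sum_expR_field (fun i => tnth h i + if i \in S then a else 0)).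
  rewrite mulr_sumr; apply: ler_sum => sigma _.
  rewrite -expRD ler_expR energyE.
  have -> : \sum_i (tnth h i + (if i \in S then a else 0)) * spin sigma i =
      a * magnetization S sigma + field_energy h sigma.
    rewrite /magnetization [in a * _]big_mkcond mulr_sumr -big_split/=.
    apply: eq_bigr => i _; rewrite mulrDl addrC; congr (_ + _).
    by case: ifP => _; rewrite ?mul0r ?mulr0.
  rewrite addrA lerD2r -subr_ge0 (_ : _ - _ = theta / (2 * k) *
    (magnetization S sigma - k * a / theta) ^+ 2).
    by rewrite mulr_ge0 ?sqr_ge0// divr_ge0 ?mulr_ge0 ?ltW.
  by field; rewrite k00 th00.
rewrite /gibbs -mulr_suml ler_pdivrMr ?partition_gt0//.
apply: le_trans low _.
apply: le_trans (ler_wpM2l _ high); last first.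
  apply: prodr_ge0 => i _; rewrite divr_ge0 ?expR_ge0// divr_ge0// ltW//;
  exact: cosh_gt0.
rewrite big_split/= prodr_const -expRM_natl -/k.
rewrite mulrACA -expRD.
rewrite (_ : _ - _ = k * (theta * eps ^+ 2 / 2)); last by ring.
rewrite ler_pM2l ?expR_gt0// le_eqVlt; apply/orP; left; apply/eqP.
rewrite big_mkcond/= -big_split/=; apply: eq_bigr => i _.
case: ifP => _; last by rewrite addr0 mul1r.
by field; rewrite !gt_eqF// cosh_gt0.
Qed.

End Magnetization.

Section LowMagnetization.
Context {R : realType} (mu : probability (measurableTypeR R) R) (theta : R).
Hypothesis theta_gt0 : 0 < theta.
Hypothesis mean_tanh : \int[mu]_h tanh h = 0.
Hypothesis low_temperature : 1 / (\int[mu]_h (sech h ^+ 2)) < theta.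

Lemma sech2 (u : R) : sech u ^+ 2 = 1 - tanh u ^+ 2.
Proof.
have e0 : expR u + expR (- u) != 0 by rewrite gt_eqF// addr_gt0// expR_gt0.
apply/eqP; rewrite -subr_eq0 /sech /tanh /sinh /cosh; apply/eqP.
transitivity (4 * (1 - expR u * expR (- u)) / (expR u + expR (- u)) ^+ 2).
  by field.
by rewrite expRxMexpNx_1 subrr mulr0 mul0r.
Qed.

Lemma measurable_sech2 : measurable_fun setT (fun u : R => sech u ^+ 2).
Proof.
rewrite (_ : (fun u => _) = fun u : R => 1 - tanh u ^+ 2); last first.
  by apply/funext => u; exact: sech2.
by apply: measurable_funB => //; apply: measurable_funX; exact: measurable_tanh.
Qed.

Lemma sech2_bound (u : R) : 0 <= sech u ^+ 2 <= 1.
Proof. by rewrite sqr_ge0 sech2 gerBl sqr_ge0. Qed.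

Lemma integrable_sech2 : mu.-integrable setT (EFin \o (fun u : R => sech u ^+ 2)).
Proof.
apply: (@bounded_integrable _ _ _ mu _ 1) => [|u]; first exact: measurable_sech2.
by have /andP[u0 u1] := sech2_bound u; rewrite ger0_norm.
Qed.

(** Positivity has to be proved, since [low_temperature] would hold trivially if
    the integral vanished, the inverse of zero being zero. *)
Lemma mean_sech2_gt0 : 0 < \int[mu]_h (sech h ^+ 2).
Proof.
rewrite lt_neqAle; apply/andP; split; last first.
  by apply: Rintegral_ge0 => u _; have /andP[] := sech2_bound u.
apply/eqP => v0.
have fin := integrable_fin_num measurableT integrable_sech2.
have : (\int[mu]_h `|(sech h ^+ 2)%:E| = 0)%E.
  under eq_integral do rewrite gee0_abs ?lee_fin ?sqr_ge0//.
  by rewrite -[LHS]fineK//; exact: (congr1 EFin (esym v0)).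
move=> /ae_eq_integral_abs => /(_ measurableT).
have mE : measurable_fun [set: R] (EFin \o (fun u : R => sech u ^+ 2)).
  by apply/measurable_EFinP; exact: measurable_sech2.
move=> /(_ mE) [N [mN N0 sub]].
have : (mu setT <= 0)%E.
  rewrite -N0; apply: le_measure; rewrite ?inE// => u _; apply: sub => /= H.
  have /eqP := H Logic.I; rewrite eqe gt_eqF// exprn_gt0// invr_gt0.
  exact: cosh_gt0.
by rewrite (_ : mu setT = 1%E) ?lee_fin ?ler10//; exact: probability_setT.
Qed.

(** What a site brings to the logarithm of the partition function tilted by [a],
    bounded below by [expR_cumulants], minus the costs of the tilt and of the
    interaction at magnetization [eps]. *)
Definition site_gain (a eps u : R) : R :=
  a * tanh u + a ^+ 2 / 2 * (1 - tanh u ^+ 2) - 11 * a ^+ 3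
  - (a ^+ 2 / (2 * theta) + theta * eps ^+ 2 / 2).

Lemma measurable_site_gain a eps : measurable_fun setT (site_gain a eps).
Proof.
do 2 apply: measurable_funB => //.
apply: measurable_funD; first by apply: measurable_funM => //; exact: measurable_tanh.
apply: measurable_funM => //; apply: measurable_funB => //.
by apply: measurable_funX; exact: measurable_tanh.
Qed.

Lemma measurable_expR_site_gain a eps lam :
  measurable_fun setT (fun u => expR (- (lam * site_gain a eps u))).
Proof.
apply: measurableT_comp => //; apply: measurable_funN.
by apply: measurable_funM => //; exact: measurable_site_gain.
Qed.

(** The mean of [site_gain] is positive, of order [a ^+ 2], exactly because
    [theta * E (sech h ^+ 2)] exceeds one; hence a small exponential moment of its
    opposite is below one. *)
Lemma expR_gain_lt1 : exists a eps lam rho : R,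
  [/\ 0 < a <= 22^-1, 0 < eps, 0 < lam <= 1, 0 < rho < 1 &
   (forall u, `|site_gain a eps u| <= 1) /\
   \int[mu]_u expR (- (lam * site_gain a eps u)) <= rho].
Proof.
pose v := \int[mu]_h (sech h ^+ 2).
have v1 : v <= 1.
  rewrite -(Rintegral_cst_probability mu 1); apply: le_Rintegral => //.
  - exact: integrable_sech2.
  - by apply: (@bounded_integrable _ _ _ mu _ 1) => // u; rewrite normr1.
  - by move=> u _; have /andP[] := sech2_bound u.
have v0 : 0 < v := mean_sech2_gt0.
have w0 : 0 < v - theta^-1.
  by rewrite subr_gt0 -[theta^-1]mul1r ltr_pdivrMr// -ltr_pdivrMl// mulrC.
have thV1 : theta^-1 <= 1 by lra.
have thV0 : 0 < theta^-1 by rewrite invr_gt0.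
set w := v - theta^-1 in w0.
(* The tilt is small enough for its cubic error to cost a quarter of the main term
   [a ^+ 2 * w], and [eps] for the interaction to cost an eighth of it. *)
pose a : R := Num.min 22^-1 (w / 44).
pose c : R := Num.min 1 (w / (4 * theta)).
have a0 : 0 < a by rewrite lt_min divr_gt0// andbT invr_gt0.
have a22 : a <= 22^-1 by rewrite ge_min lexx.
have aw : 44 * a <= w.
  by rewrite mulrC -ler_pdivlMr// ge_min lexx orbT.
have c0 : 0 < c by rewrite lt_min ltr01 divr_gt0// mulr_gt0.
have c1 : c <= 1 by rewrite ge_min lexx.
have cw : theta * c <= w / 4.
  have -> : w / 4 = theta * (w / (4 * theta)) by field; rewrite gt_eqF.
  by rewrite ler_pM2l// ge_min lexx orbT.
have a20 : 0 < a ^+ 2 by rewrite exprn_gt0.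
have a2a : a ^+ 2 <= a / 22 by rewrite expr2 ler_pM2l.
have a3w : 11 * a ^+ 3 <= a ^+ 2 * w / 4.
  by rewrite exprSr; have := ler_wpM2l (ltW a20) aw; lra.
have epsw : theta * (a * c) ^+ 2 / 2 <= a ^+ 2 * w / 8.
  have cc : theta * c ^+ 2 <= w / 4.
    apply: le_trans cw; rewrite ler_pM2l// expr2 ger_pMl//.
  by rewrite exprMn; have := ler_wpM2l (ltW a20) cc; lra.
have eps0 : 0 <= theta * (a * c) ^+ 2 / 2.
  by rewrite divr_ge0// mulr_ge0 ?sqr_ge0// ltW.
pose kappa := a ^+ 2 * w / 8.
have w1 : w <= 1 by rewrite /w; lra.
have k0 : 0 < kappa by rewrite divr_gt0// mulr_gt0.
have k1 : kappa <= 1.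
  have := ler_wpM2l (ltW a20) w1; rewrite /kappa; lra.
have th0 : theta != 0 by rewrite gt_eqF.
exists a, (a * c), (kappa / 2), (1 - kappa ^+ 2 / 4).
have aT : a ^+ 2 / (2 * theta) = a ^+ 2 * theta^-1 / 2 by field.
have aT1 : 0 <= a ^+ 2 * theta^-1 <= a ^+ 2.
  by rewrite (mulr_ge0 (ltW a20) (ltW thV0)) ger_pMr.
have aw1 : 0 <= a ^+ 2 * w <= a ^+ 2.
  by rewrite (mulr_ge0 (ltW a20) (ltW w0)) ger_pMr.
have a30 : 0 <= a ^+ 3 by rewrite exprn_ge0// ltW.
split; [by rewrite a0| by rewrite mulr_gt0| by apply/andP; split; lra| |].
  have : kappa ^+ 2 <= 1 by rewrite expr_le1// ltW.
  have : 0 < kappa ^+ 2 by rewrite exprn_gt0.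
  by move=> ? ?; apply/andP; split; lra.
set Y := site_gain a (a * c); have Y1 u : `|Y u| <= 1.
  have := tanh_bound u; rewrite ltr_norml => /andP[t1 t2].
  have : - a <= a * tanh u <= a by apply/andP; split; nra.
  have /andP[] := sech2_bound u; rewrite sech2 => s0 s1.
  have : 0 <= a ^+ 2 * (1 - tanh u ^+ 2) <= a ^+ 2.
    by rewrite (mulr_ge0 (ltW a20) s0) ger_pMr.
  rewrite /Y /site_gain aT ler_norml => /andP[? ?] /andP[? ?].
  move: aT1 aw1 => /andP[? ?] /andP[? ?].
  apply/andP; split; lra.
split => //.
have mY : measurable_fun setT Y := measurable_site_gain a (a * c).
have iY : mu.-integrable setT (EFin \o Y) by exact: (@bounded_integrable _ _ _ mu _ 1).
have EY : \int[mu]_u Y u = a ^+ 2 / 2 * v - 11 * a ^+ 3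
    - (a ^+ 2 / (2 * theta) + theta * (a * c) ^+ 2 / 2).
  pose b := - (11 * a ^+ 3) - (a ^+ 2 / (2 * theta) + theta * (a * c) ^+ 2 / 2).
  have YE : Y = fun u => (a * tanh u + a ^+ 2 / 2 * sech u ^+ 2) + b.
    by apply/funext => u; rewrite /Y /site_gain /b sech2 !addrA.
  have i1 := integrableZl measurableT a (integrable_tanh mu).
  have i2 := integrableZl measurableT (a ^+ 2 / 2) integrable_sech2.
  have i3 : mu.-integrable setT (EFin \o (fun u : measurableTypeR R => b)).
    by apply: (@bounded_integrable _ _ _ mu _ `|b|).
  rewrite YE RintegralD//; last exact: (integrableD measurableT i1 i2).
  rewrite RintegralD// Rintegral_cst_probability RintegralZl//; last exact: integrable_tanh.
  rewrite RintegralZl//; last exact: integrable_sech2.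
  by rewrite mean_tanh mulr0 add0r /b !addrA.
have EYk : kappa <= \int[mu]_u Y u.
  rewrite EY aT /kappa.
  have -> : a ^+ 2 / 2 * v = a ^+ 2 * w / 2 + a ^+ 2 * theta^-1 / 2 by rewrite /w; field.
  lra.
pose lam := kappa / 2.
have lam0 : 0 < lam by rewrite divr_gt0.
have lam1 : lam <= 2^-1 by rewrite /lam; lra.
apply: (@le_trans _ _ (\int[mu]_u ((1 + lam ^+ 2) + (- lam) * Y u))); last first.
  have i1 : mu.-integrable setT (EFin \o (fun u : measurableTypeR R => 1 + lam ^+ 2)).
    by apply: (@bounded_integrable _ _ _ mu _ `|1 + lam ^+ 2|).
  rewrite RintegralD//; last exact: (integrableZl measurableT (- lam) iY).
  rewrite Rintegral_cst_probability RintegralZl//.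
  have := ler_wpM2l (ltW lam0) EYk; rewrite /lam; lra.
have lamY u : `|- (lam * Y u)| <= lam.
  by rewrite normrN normrM gtr0_norm// ger_pMr.
apply: le_Rintegral => //.
- apply: (@bounded_integrable _ _ _ mu _ (expR 1)).
    exact: measurable_expR_site_gain.
  move=> u; rewrite ger0_norm ?expR_ge0// ler_expR.
  by apply: le_trans (ler_norm _) _; apply: le_trans (lamY u) _; lra.
- apply: (@bounded_integrable _ _ _ mu _ (`|1 + lam ^+ 2| + lam)).
    by apply: measurable_funD => //; apply: measurable_funM.
  by move=> u; rewrite (le_trans (ler_normD _ _))// lerD2l mulNr.
move=> u _; apply: le_trans (expR_le_cubic (le_trans (lamY u) lam1)) _.
set z := - (lam * Y u); have z1 : `|z| <= lam := lamY u.
have z2 : z ^+ 2 <= lam ^+ 2.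
  by rewrite -[leLHS]ger0_norm ?sqr_ge0// normrX lerXn2r ?nnegrE// ltW.
have z3 : `|z| ^+ 3 <= z ^+ 2 / 2.
  rewrite -[in leRHS](real_normK (num_real z)) exprSr ler_wpM2l ?sqr_ge0//.
  lra.
rewrite mulNr -/z; lra.
Qed.

(** Given the field, with [s] the sum of the gains over [S], a low magnetization has
    probability at most [Num.min 1 (expR (- s)) <= expR (- (lam * s))], which
    factorizes over the independent sites. *)
Lemma planted_low_magnetization : exists2 eps : R, 0 < eps &
  exists2 rho : R, 0 < rho < 1 & forall n (S : {set 'I_n}), (0 < #|S|)%N ->
  \sum_(sigma | `|magnetization S sigma| <= eps * #|S|%:R)
     planted_pmf mu theta S sigma <= rho ^+ #|S|.
Proof.
have [a [eps [lam [rho [/andP[a0 a1] eps0 /andP[lam0 lam1] rho01 []]]]]] :=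
  expR_gain_lt1.
set Y := site_gain a eps => Y1 Yrho.
exists eps => //; exists rho => // n S S0.
pose f i (u : measurableTypeR R) : R := if i \in S then expR (- (lam * Y u)) else 1.
have mf i : measurable_fun setT (f i).
  by rewrite /f; case: (i \in S) => //; exact: measurable_expR_site_gain.
have f0 i u : 0 <= f i u by rewrite /f; case: ifP => _ //; exact: expR_ge0.
have f1 i u : f i u <= expR 1.
  rewrite /f; case: ifP => _; last by rewrite -[leLHS]expR0 ler_expR.
  rewrite ler_expR (le_trans (ler_norm _))// normrN normrM gtr0_norm//.
  by rewrite (le_trans _ lam1)// ger_pMr.
have if_ i : mu.-integrable setT (EFin \o f i).
  by apply: (@bounded_integrable _ _ _ mu _ (expR 1)) => // u; rewrite ger0_norm.
pose F (h : n.-tuple (measurableTypeR R)) : R := \prod_i f i (tnth h i).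
have mF : measurable_fun setT F.
  apply: measurable_prod => i _; apply: (measurableT_comp (mf i)).
  exact: measurable_tnth_real.
have iF : (iid_law mu n).-integrable setT (EFin \o F).
  apply: (@bounded_integrable _ _ _ (iid_law mu n) _ (\prod_(i < n) expR 1)) => // h.
  rewrite ger0_norm; last by apply: prodr_ge0.
  by apply: ler_prod => i _; rewrite f0 f1.
have [iG <-] := Rintegral_sum (index_enum (config n))
  (fun sigma => `|magnetization S sigma| <= eps * #|S|%:R)
  (@integrable_planted_gibbs _ mu theta n S).
apply: (@le_trans _ _ (\int[iid_law mu n]_h F h)).
  apply: le_Rintegral => // h _.
  pose s := \sum_(i in S) Y (tnth h i).
  have FE : F h = expR (- (lam * s)).
    rewrite mulr_sumr -sumrN expR_sum [RHS]big_mkcond /=.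
    by apply: eq_bigr => i _; rewrite /f; case: ifP.
  set L := (X in X <= _).
  have L1 : L <= 1.
    rewrite -(sum_gibbs (planted_energy theta S h)) [leRHS](bigID
      (fun sigma => `|magnetization S sigma| <= eps * #|S|%:R))/= lerDl.
    by apply: sumr_ge0 => sigma _; exact: gibbs_ge0.
  have Ls : L <= expR (- s).
    apply: le_trans (gibbs_low_magnetization a eps h theta_gt0 S0) _.
    rewrite -sumrN expR_sum; apply: ler_prod => i _.
    have G0 : 0 < cosh (tnth h i + a) / cosh (tnth h i).
      by rewrite divr_gt0 ?cosh_gt0.
    rewrite (divr_ge0 (expR_ge0 _) (ltW G0)) ler_pdivrMr//=.
    rewrite cosh_ratio; set A := _ / (2 * theta) + _.
    have -> : expR A = expR (- Y (tnth h i)) * expR (Y (tnth h i) + A).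
      by rewrite -expRD addKr.
    rewrite ler_pM2l ?expR_gt0// /Y /site_gain addrNK.
    by apply: expR_cumulants; rewrite ?a0// ltW// tanh_bound.
  rewrite FE; have [s0|s0] := leP 0 s.
    by apply: le_trans Ls _; rewrite ler_expR lerN2 ler_piMl.
  apply: le_trans L1 _; rewrite -[leLHS]expR0 ler_expR oppr_ge0.
  by rewrite pmulr_rle0// ltW.
have -> : \int[iid_law mu n]_h F h = \prod_(i < n) \int[mu]_u f i u.
  rewrite /Rintegral ge0_integral_iid_prod//.
  rewrite (_ : (\prod_(i < n) \int[mu]_u (f i u)%:E)%E =
    (\prod_(i < n) \int[mu]_u f i u)%:E)//.
  rewrite -prodEFin; apply: eq_bigr => i _.
  by rewrite fineK//; exact: (integrable_fin_num measurableT (if_ i)).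
rewrite -prodr_const [leRHS]big_mkcond; apply: ler_prod => i _.
rewrite Rintegral_ge0//=.
rewrite /f; case: ifP => _; first exact: Yrho.
by rewrite Rintegral_cst_probability.
Qed.

End LowMagnetization.

(** * Independent samples *)

Section Samples.
Context {R : realType} (n m : nat) (p : config n -> R).
Hypothesis p_ge0 : forall sigma, 0 <= p sigma.
Hypothesis p_sum1 : \sum_sigma p sigma = 1.
Implicit Types (g : config n -> R) (F G : samples n m -> R).

Definition mean g : R := \sum_sigma p sigma * g sigma.

Definition sample_mean F : R := \sum_(s : samples n m) (\prod_(j < m) p (tnth s j)) * F s.

Lemma sample_mean_prod (g : 'I_m -> config n -> R) :
  sample_mean (fun s => \prod_j g j (tnth s j)) = \prod_j mean (g j).
Proof.
rewrite /sample_mean /mean bigA_distr_bigA/=.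
rewrite (reindex (fun f : {ffun 'I_m -> config n} => [tuple f j | j < m])) /=.
  apply: eq_bigr => f _; rewrite -big_split/=; apply: eq_bigr => j _.
  by rewrite tnth_mktuple.
exists (fun s : samples n m => [ffun j => tnth s j]) => [f _|s _].
  by apply/ffunP => j; rewrite ffunE tnth_mktuple.
by apply: eq_from_tnth => j; rewrite tnth_mktuple ffunE.
Qed.

Lemma mean1 : mean (fun=> 1) = 1.
Proof. by rewrite -[RHS]p_sum1; apply: eq_bigr => sigma _; rewrite mulr1. Qed.

Lemma meanD g h : mean (fun sigma => g sigma + h sigma) = mean g + mean h.
Proof. by rewrite -big_split/=; apply: eq_bigr => s _; rewrite mulrDr. Qed.

Lemma meanZ c g : mean (fun sigma => c * g sigma) = c * mean g.
Proof. by rewrite mulr_sumr; apply: eq_bigr => s _; rewrite mulrCA. Qed.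

Lemma eq_sample_mean F G : F =1 G -> sample_mean F = sample_mean G.
Proof. by move=> FG; apply: eq_bigr => s _; rewrite FG. Qed.

Lemma sample_mean_coord g (j : 'I_m) :
  sample_mean (fun s => g (tnth s j)) = mean g.
Proof.
pose g' l := if l == j then g else fun=> 1.
rewrite (eq_sample_mean (G := fun s => \prod_l g' l (tnth s l))).
  rewrite sample_mean_prod (bigD1 j)//= {1}/g' eqxx big1 ?mulr1// => l.
  by rewrite /g' => /negbTE ->; exact: mean1.
move=> s; rewrite (bigD1 j)//= {1}/g' eqxx big1 ?mulr1// => l.
by rewrite /g' => /negbTE ->.
Qed.

Lemma sample_mean_coord2 g1 g2 (i j : 'I_m) : i != j ->
  sample_mean (fun s => g1 (tnth s i) * g2 (tnth s j)) = mean g1 * mean g2.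
Proof.
move=> ij; pose g l := if l == i then g1 else if l == j then g2 else fun=> 1.
have gi : g i = g1 by rewrite /g eqxx.
have gj : g j = g2 by rewrite /g eq_sym (negbTE ij) eqxx.
have gl l : (l != i) && (l != j) -> g l = fun=> 1.
  by rewrite /g => /andP[/negbTE -> /negbTE ->].
have ji : j != i by rewrite eq_sym.
rewrite (eq_sample_mean (G := fun s => \prod_l g l (tnth s l))).
  rewrite sample_mean_prod (bigD1 i)//= (bigD1 j)//= gi gj big1 ?mulr1//.
  by move=> l /gl ->; exact: mean1.
move=> s; rewrite (bigD1 i)//= (bigD1 j)//= gi gj big1 ?mulr1//.
by move=> l /gl ->.
Qed.

Lemma sample_mean_sum (I : finType) (F : I -> samples n m -> R) :
  sample_mean (fun s => \sum_i F i s) = \sum_i sample_mean (F i).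
Proof.
rewrite /sample_mean exchange_big/=; apply: eq_bigr => s _.
by rewrite mulr_sumr.
Qed.

Lemma sample_meanZ c F : sample_mean (fun s => c * F s) = c * sample_mean F.
Proof. by rewrite mulr_sumr; apply: eq_bigr => s _; rewrite mulrCA. Qed.

Lemma sample_weight_ge0 (s : samples n m) : 0 <= \prod_(j < m) p (tnth s j).
Proof. by apply: prodr_ge0. Qed.

Lemma prod_prob_ge0 (A : pred (samples n m)) : 0 <= prod_prob p A.
Proof. by apply: sumr_ge0 => s _; exact: sample_weight_ge0. Qed.

Lemma le_prod_prob (A B : pred (samples n m)) :
  (forall s, A s -> B s) -> prod_prob p A <= prod_prob p B.
Proof.
move=> AB; rewrite /prod_prob big_mkcond [leRHS]big_mkcond/=.
apply: ler_sum => s _; case: ifP => [/AB ->//|_].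
by case: ifP => // _; exact: sample_weight_ge0.
Qed.

Lemma prod_prob_union (I : finType) (Q : pred I) (A : I -> pred (samples n m)) :
  prod_prob p (fun s => [exists i, Q i && A i s]) <=
  \sum_(i | Q i) prod_prob p (A i).
Proof.
rewrite /prod_prob big_mkcond/= [leRHS](eq_bigr (fun i =>
  \sum_s if A i s then \prod_(j < m) p (tnth s j) else 0)); last first.
  by move=> i _; rewrite big_mkcond.
rewrite exchange_big/=; apply: ler_sum => s _.
case: existsP => [[i /andP[Qi Ai]]|_].
  rewrite (bigD1 i)//= Ai lerDl; apply: sumr_ge0 => l _.
  by case: ifP => // _; exact: sample_weight_ge0.
apply: sumr_ge0 => l _; case: ifP => // _; exact: sample_weight_ge0.
Qed.

Lemma prod_prob_markov (A : pred (samples n m)) F :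
  (forall s, 0 <= F s) -> (forall s, A s -> 1 <= F s) ->
  prod_prob p A <= sample_mean F.
Proof.
move=> F0 F1; rewrite /prod_prob big_mkcond/=; apply: ler_sum => s _.
case: ifP => [/F1 As|_]; first by rewrite ler_peMr// sample_weight_ge0.
by rewrite mulr_ge0// sample_weight_ge0.
Qed.

Lemma sample_mean_average g : (0 < m)%N ->
  sample_mean (fun s => m%:R^-1 * \sum_j g (tnth s j)) = mean g.
Proof.
move=> m0; rewrite sample_meanZ sample_mean_sum.
under eq_bigr do rewrite sample_mean_coord.
by rewrite sumr_const card_ord -(mulr_natl (mean _)) mulKf// pnatr_eq0 -lt0n.
Qed.

Lemma sample_variance g : (0 < m)%N ->
  sample_mean (fun s => (m%:R^-1 * \sum_j g (tnth s j) - mean g) ^+ 2) <=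
  mean (fun sigma => g sigma ^+ 2) / m%:R.
Proof.
move=> m0; have mn0 : m%:R != 0 :> R by rewrite pnatr_eq0 -lt0n.
(* Centring makes the terms off the diagonal of the double sum vanish. *)
pose g0 sigma := g sigma - mean g.
have g00 : mean g0 = 0.
  rewrite /mean /g0; under eq_bigr do rewrite mulrBr.
  by rewrite sumrB -mulr_suml p_sum1 mul1r subrr.
have g02 : mean (fun sigma => g0 sigma ^+ 2) <= mean (fun sigma => g sigma ^+ 2).
  rewrite -subr_ge0 -sumrB (eq_bigr (fun sigma =>
    2 * mean g * (p sigma * g0 sigma) + mean g ^+ 2 * p sigma)).
    rewrite big_split/= -!mulr_sumr -/(mean g0) g00 mulr0 add0r p_sum1 mulr1.
    exact: sqr_ge0.
  by move=> sigma _; rewrite /g0; ring.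
rewrite (eq_sample_mean (G := fun s => m%:R ^- 2 *
    \sum_i \sum_j g0 (tnth s i) * g0 (tnth s j))); last first.
  move=> s; have -> : \sum_i \sum_j g0 (tnth s i) * g0 (tnth s j) =
      (\sum_j g0 (tnth s j)) ^+ 2.
    by rewrite expr2 mulr_suml; apply: eq_bigr => i _; rewrite mulr_sumr.
  rewrite -exprVn -exprMn; congr (_ ^+ 2).
  rewrite /g0 sumrB sumr_const card_ord -(mulr_natl (mean _)) mulrBr; congr (_ - _).
  by rewrite mulKf.
rewrite sample_meanZ sample_mean_sum.
rewrite (eq_bigr (fun=> mean (fun sigma => g0 sigma ^+ 2))); last first.
  move=> i _; rewrite sample_mean_sum (bigD1 i)//= big1 ?addr0; last first.
    by move=> j ji; rewrite sample_mean_coord2 1?eq_sym// g00 mul0r.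
  by rewrite (sample_mean_coord (fun sigma => g0 sigma * g0 sigma)).
rewrite sumr_const card_ord -(mulr_natl (mean _)) mulrA.
rewrite (_ : m%:R ^- 2 * m%:R = m%:R^-1); last by field.
by rewrite mulrC ler_pM2r// invr_gt0 ltr0n.
Qed.

Lemma prod_prob_chebyshev g (eta : R) (A : pred (samples n m)) :
  (0 < m)%N -> 0 < eta ->
  (forall s, A s -> eta <= `|m%:R^-1 * \sum_j g (tnth s j) - mean g|) ->
  prod_prob p A <= mean (fun sigma => g sigma ^+ 2) / (m%:R * eta ^+ 2).
Proof.
move=> m0 eta0 HA.
apply: (@le_trans _ _ (sample_mean (fun s =>
    (eta ^+ 2)^-1 * (m%:R^-1 * \sum_j g (tnth s j) - mean g) ^+ 2))).
  apply: prod_prob_markov => s; first by rewrite mulr_ge0 ?invr_ge0 ?sqr_ge0.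
  move=> /HA /(lerXn2r 2) - /(_ _ _) H; rewrite ler_pdivlMl ?exprn_gt0// mulr1.
  by rewrite -[leRHS]ger0_norm ?sqr_ge0// normrX H// nnegrE// ltW.
rewrite sample_meanZ [leRHS](_ : _ = (eta ^+ 2)^-1 *
  (mean (fun sigma => g sigma ^+ 2) / m%:R)).
  by rewrite ler_pM2l ?invr_gt0 ?exprn_gt0//; exact: sample_variance.
by field; rewrite !gt_eqF// ltr0n.
Qed.

End Samples.

(** * The simple random walk *)

Section Walk.
Context {R : realType}.
Implicit Types (f g : R -> R) (x y : R).

(** [walk n f x] is the mean of [f] at time [n] of the simple random walk
    started at [x]. *)
Fixpoint walk n f x : R :=
  if n is n'.+1 then (walk n' f (x + 1) + walk n' f (x - 1)) / 2 else f x.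

Lemma walkD n f g x : walk n (fun y => f y + g y) x = walk n f x + walk n g x.
Proof. by elim: n x => [//|n IHn] x /=; rewrite !IHn; lra. Qed.

Lemma walkZ n c f x : walk n (fun y => c * f y) x = c * walk n f x.
Proof. by elim: n x => [//|n IHn] x /=; rewrite !IHn; lra. Qed.

Lemma walk_cst n c x : walk n (fun=> c) x = c.
Proof. by elim: n x => [//|n IHn] x /=; rewrite !IHn; lra. Qed.

Lemma walk_add n m f x : walk (n + m) f x = walk n (walk m f) x.
Proof. by elim: n x => [//|n IHn] x /=; rewrite !IHn. Qed.

Lemma walkSr n f x : walk n.+1 f x = walk n (fun y => (f (y + 1) + f (y - 1)) / 2) x.
Proof. by rewrite -addn1 walk_add. Qed.

Lemma walk_shift n f x c : walk n f (x + c) = walk n (fun y => f (y + c)) x.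
Proof. by elim: n x => [//|n IHn] x /=; rewrite (addrAC x c 1) (addrAC x c (-1)) !IHn. Qed.

Lemma walk_opp n f x : walk n f (- x) = walk n (fun y => f (- y)) x.
Proof.
elim: n x => [//|n IHn] x /=; rewrite -!IHn opprD opprB.
by congr (_ / 2); rewrite addrC [1 - x]addrC.
Qed.

Lemma le_walk n f g x : (forall y, f y <= g y) -> walk n f x <= walk n g x.
Proof.
by move=> fg; elim: n x => [//|n IHn] x /=; rewrite ler_pM2r ?invr_gt0// lerD.
Qed.

(** The walk only visits points of the parity of [n]. *)
Lemma eq_walk_lattice n f g x :
  (forall j, (j <= n)%N -> f (x + n%:R - 2 * j%:R) = g (x + n%:R - 2 * j%:R)) ->
  walk n f x = walk n g x.
Proof.
elim: n x => [|n IHn] x fg /=; first by have := fg 0 (leqnn _); rewrite mulr0 subr0 addr0.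
congr ((_ + _) / 2); apply: IHn => j jn.
  have := fg j (leqW jn); rewrite -(natr1 n) (_ : x + (n%:R + 1) = x + 1 + n%:R)//; ring.
have := fg j.+1 jn.
rewrite (_ : x + _ - _ = x - 1 + n%:R - 2 * j%:R)//.
by rewrite -(natr1 n) -(natr1 j); ring.
Qed.

Lemma walk_pow4 n x :
  walk n (fun y => y ^+ 4) x = x ^+ 4 + 6 * x ^+ 2 * n%:R + 3 * n%:R ^+ 2 - 2 * n%:R.
Proof. by elim: n x => [|n IHn] x /=; rewrite ?IHn -?(natr1 n); [ring|field]. Qed.

(** Discrete integration by parts. *)
Lemma walk_mul n f x : walk n.+1 (fun y => y * f y) x =
  x * walk n.+1 f x + n.+1%:R * walk n (fun y => (f (y + 1) - f (y - 1)) / 2) x.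
Proof.
pose D n z := walk n (fun y => (f (y + 1) - f (y - 1)) / 2) z.
have DE k z : D k z = (walk k f (z + 1) - walk k f (z - 1)) / 2.
  rewrite /D !walk_shift -[- walk _ _ _]mulN1r -walkZ -walkD mulrC -walkZ.
  by congr walk; apply/funext => y; rewrite mulrC mulN1r.
elim: n x => [|n IHn] x; first by rewrite /=; field.
transitivity ((walk n.+1 (fun y => y * f y) (x + 1) +
  walk n.+1 (fun y => y * f y) (x - 1)) / 2) => //.
rewrite !IHn -!/(D _ _) !DE addrK subrK.
have W z : walk n.+1 f z = (walk n f (z + 1) + walk n f (z - 1)) / 2 by [].
have -> : walk n.+2 f x = (walk n.+1 f (x + 1) + walk n.+1 f (x - 1)) / 2 by [].
rewrite -(natr1 n.+1) !W addrK subrK; set N := n.+1%:R.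
move: (walk n f (x + 1 + 1)) (walk n f x) (walk n f (x - 1 - 1)) => w1 w2 w3.
by field.
Qed.

Definition abs_walk n : R := walk n (@Num.norm _ R) 0.

(** At an odd time the walk is not at the origin, so the next step changes its
    distance by a centred amount. *)
Lemma abs_walk_oddS j : abs_walk j.*2.+2 = abs_walk j.*2.+1.
Proof.
rewrite /abs_walk walkSr; apply: eq_walk_lattice => i _; rewrite add0r.
set y := _ - 2 * _; have : (1 <= y) \/ (y <= -1).
  have -> : y = (1 + 2 * (j%:R - i%:R)).
    by rewrite /y -(natr1 j.*2) -mul2n natrM; ring.
  have [ij|ij] := leqP i j; first by left; have := ij; rewrite -(ler_nat R); lra.
  by right; have := ij; rewrite -(ler_nat R) -natr1; lra.
by case=> y1; [rewrite !ger0_norm|rewrite !ler0_norm]; lra.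
Qed.

(** Integrating [y * Num.sg y] by parts, only the visits to the origin contribute,
    and they are also what makes the mean distance grow at an even time. *)
Lemma abs_walk_even j :
  j.*2%:R * abs_walk j.*2.+1 = j.*2.+1%:R * abs_walk j.*2.
Proof.
have absE : abs_walk j.*2.+1 = j.*2.+1%:R * (abs_walk j.*2.+1 - abs_walk j.*2).
  rewrite {1}/abs_walk (_ : Num.norm = fun y : R => y * Num.sg y); last first.
    by apply/funext => y; rewrite normrEsg mulrC.
  rewrite walk_mul mul0r add0r; congr (_ * _).
  rewrite /abs_walk walkSr -[- walk _ _ _]mulN1r -walkZ -walkD.
  apply: eq_walk_lattice => i _; rewrite add0r.
  set y := _ - 2 * _; have : [\/ (2 <= y), (y <= -2) | y = 0].
    have -> : y = 2 * (j%:R - i%:R) by rewrite /y -mul2n natrM; ring.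
    have [ij|ij|->] := ltngtP i j; last by rewrite subrr mulr0; exact: Or33.
      by apply: Or31; have := ij; rewrite -(ler_nat R) -natr1; lra.
    by apply: Or32; have := ij; rewrite -(ler_nat R) -natr1; lra.
  case=> [y2|y2|->].
  - by rewrite !gtr0_sg ?ger0_norm; lra.
  - by rewrite !ltr0_sg ?ler0_norm; lra.
  - by rewrite add0r sub0r sgrN sgr1 normrN normr1 normr0; lra.
have j1 : j.*2.+1%:R = j.*2%:R + 1 :> R by rewrite natr1.
move: absE; rewrite j1; lra.
Qed.

Lemma abs_walk_ge0 n : 0 <= abs_walk n.
Proof. by rewrite -(walk_cst n 0 0); apply: le_walk. Qed.

End Walk.

(** * Wallis' product *)

Section Wallis.
Context {R : realType}.
Implicit Types t : R.

(** The antiderivative of [cos ^+ n] vanishing at the origin. *)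
Fixpoint wallis n t : R :=
  match n with
  | 0 => t
  | 1 => sin t
  | (n'.+1 as n1).+1 => cos t ^+ n1 * sin t / n1.+1%:R + n1%:R / n1.+1%:R * wallis n' t
  end.

Lemma is_derive_wallis n t : is_derive t 1 (wallis n) (cos t ^+ n).
Proof.
suff [] : is_derive t 1 (wallis n) (cos t ^+ n) /\
  is_derive t 1 (wallis n.+1) (cos t ^+ n.+1) by [].
elim: n => [|n [IH0 IH1]].
  by split; apply: is_derive_eq.
split => //.
have n20 : n.+2%:R != 0 :> R by rewrite pnatr_eq0.
have d1 : is_derive t 1 (fun s => cos s ^+ n.+1) (n.+1%:R * cos t ^+ n * (- sin t)).
  rewrite (_ : (fun s => _) = cos ^+ n.+1); last first.
    by apply/funext => s; rewrite exprfctE.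
  exact: is_deriveX.
have F : is_derive t 1 (fun s => cos s ^+ n.+1 * sin s / n.+2%:R +
    n.+1%:R / n.+2%:R * wallis n s) (cos t ^+ n.+2).
  apply: is_derive_eq; rewrite /GRing.scale /= ?fctE.
  have s2 : sin t ^+ 2 = 1 - cos t ^+ 2 by rewrite sin2cos2.
  have -> : sin t * (n.+1%:R * cos t ^+ n * - sin t) =
      - (n.+1%:R * cos t ^+ n * sin t ^+ 2) by ring.
  rewrite s2 !exprS; move: n20; rewrite -(natr1 n.+1) => n20.
  by field.
exact: F.
Qed.

Lemma wallis0 n : wallis n 0 = 0.
Proof.
suff [] : wallis n 0 = 0 /\ wallis n.+1 0 = 0 by [].
elim: n => [|n [IH0 IH1]]; first by rewrite /= sin0.
by split => //; rewrite [LHS]/= sin0 mulr0 mul0r add0r IH0 mulr0.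
Qed.

(** The integral of [cos ^+ n] over [[0, pi / 2]]. *)
Definition wallis_integral n : R := wallis n (pi / 2).

Lemma wallis_integralSS n :
  n.+2%:R * wallis_integral n.+2 = n.+1%:R * wallis_integral n.
Proof.
rewrite /wallis_integral /= cos_pihalf expr0n /= !mul0r add0r mulrA.
by rewrite mulrCA divff ?mulr1// pnatr_eq0.
Qed.

Lemma wallis_integral_nincr n : wallis_integral n.+1 <= wallis_integral n.
Proof.
have dW t : is_derive t 1 (fun s => wallis n s - wallis n.+1 s)
    (cos t ^+ n - cos t ^+ n.+1).
  by apply: (is_deriveB (is_derive_wallis n t) (is_derive_wallis n.+1 t)).
have pi0 : 0 <= pi / 2 :> R by rewrite divr_ge0// pi_ge0.
have := is_derive_ge0_le dW _ pi0; rewrite !wallis0 subrr subr_ge0; apply.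
move=> t /andP[t0 t1]; have c0 : 0 <= cos t.
  by apply: cos_ge0_pihalf; rewrite (ltW t1) andbT; have := pi_gt0 R; lra.
by rewrite exprSr -{1}[cos t ^+ n]mulr1 -mulrBr mulr_ge0 ?exprn_ge0// subr_ge0 cos_le1.
Qed.

Lemma wallis_integralM n : n.+1%:R * (wallis_integral n.+1 * wallis_integral n) = pi / 2.
Proof.
elim: n => [|n IHn]; first by rewrite /wallis_integral /= sin_pihalf !mul1r.
by rewrite mulrA wallis_integralSS -IHn; ring.
Qed.

Lemma wallis_integral_gt0 n : 0 < wallis_integral n.
Proof.
suff [] : 0 < wallis_integral n /\ 0 < wallis_integral n.+1 by [].
elim: n => [|n [IH0 IH1]].
  by rewrite /wallis_integral /= sin_pihalf divr_gt0 ?pi_gt0.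
split => //; rewrite -(pmulr_rgt0 _ (ltr0Sn R n.+1)) wallis_integralSS.
by rewrite mulr_gt0// ltr0n.
Qed.

(** The two sequences obey inverse recursions. *)
Lemma abs_walk_wallis j : @abs_walk R j.*2.+2 * wallis_integral j.*2.+1 = 1.
Proof.
elim: j => [|j IHj].
  rewrite (@abs_walk_oddS R 0) /abs_walk /wallis_integral /= sin_pihalf mulr1.
  by rewrite add0r sub0r normrN normr1; field.
have j0 : j.*2.+3%:R != 0 :> R by rewrite pnatr_eq0.
have j1 : j.*2.+2%:R != 0 :> R by rewrite pnatr_eq0.
have e1 := @abs_walk_oddS R j.+1; have e2 := @abs_walk_even R j.+1.
have e3 := wallis_integralSS j.*2.+1.
rewrite !doubleS in e1 e2 *; rewrite e1.
apply: (mulfI j0); apply: (mulfI j1).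
transitivity ((j.*2.+2%:R * @abs_walk R j.*2.+3) *
  (j.*2.+3%:R * wallis_integral j.*2.+3)); first by ring.
rewrite e2 e3.
transitivity (j.*2.+3%:R * j.*2.+2%:R *
  (@abs_walk R j.*2.+2 * wallis_integral j.*2.+1)); first by ring.
by rewrite IHj; ring.
Qed.

(** Consecutive Wallis integrals decrease and have the known product
    [wallis_integralM], which squeezes the square of each of them. *)
Lemma abs_walk_sqr n : (0 < n)%N ->
  2 / pi * (n%:R - 1) <= @abs_walk R n ^+ 2 <= 2 / pi * (n%:R + 1).
Proof.
have pi0 := pi_gt0 R.
have even j : 2 / pi * j.*2.+1%:R <= @abs_walk R j.*2.+2 ^+ 2 <= 2 / pi * j.*2.+2%:R.
  have W0 := wallis_integral_gt0 j.*2.+1; have A := abs_walk_wallis j.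
  have AE : @abs_walk R j.*2.+2 = (wallis_integral j.*2.+1)^-1.
    by apply: (mulIf (lt0r_neq0 W0)); rewrite A mulVf// gt_eqF.
  have M1 := wallis_integralM j.*2.+1; have D1 := wallis_integral_nincr j.*2.+1.
  have M0 := wallis_integralM j.*2; have D0 := wallis_integral_nincr j.*2.
  rewrite AE exprVn; set W := wallis_integral j.*2.+1 in W0 M1 D1 M0 D0 *.
  have W20 : 0 < W ^+ 2 by rewrite exprn_gt0.
  have piV : 2 / pi = (pi / 2 : R)^-1 by rewrite invf_div.
  apply/andP; split.
    rewrite piV -ler_pdivlMl ?invr_gt0 ?divr_gt0// invrK.
    rewrite ler_pdivlMr// -M0 ler_pM2l ?ltr0n// expr2 ler_pM2l//.
  rewrite piV -[leRHS]mulrC ler_pdivlMr ?divr_gt0// mulrC ler_pdivrMr// -M1.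
  by rewrite ler_pM2l ?ltr0n// expr2 ler_pM2r.
move=> n0; have [j [->|->]] : exists j, n = j.*2.+2 \/ n = j.*2.+1.
  exists n.-1./2; rewrite -{1 3}(prednK n0) -{1 3}[n.-1]odd_double_half.
  by case: (odd _); [left|right].
  have /andP[l u] := even j; have p2 : 0 < 2 / pi :> R by rewrite divr_gt0.
  rewrite (le_trans _ l) ?(le_trans u)// ler_pM2l//; first by rewrite lerDl.
  by rewrite -(natr1 j.*2.+1); lra.
have /andP[l u] := even j; have p2 : 0 < 2 / pi :> R by rewrite divr_gt0.
rewrite -abs_walk_oddS (le_trans _ l) ?(le_trans u)// ler_pM2l//.
  by rewrite -(natr1 j.*2.+1).
by rewrite gerDl.
Qed.

End Wallis.

(** * Mean distances: asymptotics, and the gain of a maximum *)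

Section WalkGain.
Context {R : realType}.

Lemma normD_normB (y s : R) : `|y + s| + `|y - s| = 2 * Num.max `|y| `|s|.
Proof.
case: leP; case: (ger0P (y + s)) => ?; case: (ger0P (y - s)) => ?;
  case: (ger0P y) => ?; case: (ger0P s) => ? ?; lra.
Qed.

(** [`|S_n + S'_m|] has the mean of the larger of the two independent distances, so
    [m] further steps gain at most what [Num.max `|S_n| L] gains over [`|S_n|], up to
    the rare event that [`|S'_m|] exceeds [L]. *)
Lemma walk_max_ge n m (L : R) : 0 < L ->
  abs_walk (n + m) - 3 * m%:R ^+ 2 / L ^+ 3 <= walk n (fun y => Num.max `|y| L) 0.
Proof.
move=> L0; rewrite lerBlDr /abs_walk walk_add.
set e := 3 * _ / _; have -> : walk n (fun y => Num.max `|y| L) 0 + e =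
    walk n (fun y => Num.max `|y| L + e) 0 by rewrite walkD walk_cst.
apply: le_walk => y.
have evenE : walk m Num.norm y = walk m (fun s => Num.max `|y| `|s|) 0.
  have h : walk m Num.norm y = walk m (fun s => `|y + s|) 0.
    rewrite -[in LHS](add0r y) walk_shift; congr walk; apply/funext => s.
    by rewrite addrC.
  have h' : walk m Num.norm y = walk m (fun s => `|y - s|) 0.
    rewrite h -[in LHS](oppr0 R) walk_opp; congr walk.
  apply: (@mulfI _ 2); rewrite ?pnatr_eq0// mulr2n mulrDl mul1r {1}h h' -walkD -walkZ.
  congr walk; apply/funext => s.
  exact: normD_normB.
rewrite evenE.
have L3 : 0 < L ^+ 3 by rewrite exprn_gt0.
apply: (@le_trans _ _ (walk m (fun s => Num.max `|y| L + (L ^+ 3)^-1 * s ^+ 4) 0)).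
  apply: le_walk => s; have s4 : 0 <= (L ^+ 3)^-1 * s ^+ 4.
    by rewrite mulr_ge0 ?invr_ge0 ?(ltW L3)// exprn_even_ge0.
  have [sL|Ls] := leP `|s| L.
    by rewrite ler_wpDr// ge_max !le_max lexx sL orbT.
  rewrite ge_max; apply/andP; split; first by rewrite ler_wpDr// le_max lexx.
  apply: ler_wpDl; first by rewrite le_max normr_ge0.
  rewrite mulrC ler_pdivlMr// -[s ^+ 4]ger0_norm ?exprn_even_ge0// normrX.
  rewrite [`|s| ^+ 4]exprS ler_wpM2l// lerXn2r ?nnegrE//; exact: ltW.
rewrite walkD walk_cst walkZ walk_pow4 lerD2l !expr0n /= mulr0 mul0r !add0r.
rewrite /e mulrC ler_pM2r ?invr_gt0// gerBl mulr_ge0// ler0n.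
Qed.

Lemma abs_walk_sqrt n : (0 < n)%N ->
  `|abs_walk n - Num.sqrt (2 * n%:R / pi)| <= 1 :> R.
Proof.
move=> n0; have /andP[lo hi] := @abs_walk_sqr R n n0.
have e0 := @abs_walk_ge0 R n; set e := abs_walk n in lo hi e0 *.
have p0 := pi_gt0 R; have p2 := pi_ge2 R.
have n1 : 1 <= n%:R :> R by rewrite ler1n.
set u : R := 2 / pi in lo hi.
have u0 : 0 < u by rewrite divr_gt0.
have u1 : u <= 1 by rewrite ler_pdivrMr ?mul1r.
set q := Num.sqrt _; have q0 : 0 <= q by exact: sqrtr_ge0.
have q2 : q ^+ 2 = u * n%:R.
  rewrite sqr_sqrtr; first by rewrite mulrAC.
  by rewrite divr_ge0 ?(ltW p0)// mulr_ge0.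
rewrite ler_norml; apply/andP; split.
  by have [q1|q1] := leP q 1; [lra|nra].
nra.
Qed.

(** With [m] about [beta ^+ 3 * n / 36] further steps, the mean distance grows by
    order [m / Num.sqrt n], which beats the fourth-moment error of
    [walk_max_ge]. *)
Lemma walk_max_gain n (beta : R) : (0 < n)%N -> 0 < beta <= 1 ->
  Num.sqrt (2 * n%:R / pi) + beta ^+ 3 * Num.sqrt n%:R / 432 - 2 <=
  walk n (fun y => Num.max `|y| (beta * Num.sqrt n%:R)) 0.
Proof.
move=> n0 /andP[b0 b1]; have n1 : 1 <= n%:R :> R by rewrite ler1n.
set s := Num.sqrt n%:R.
have s1 : 1 <= s by rewrite -sqrtr1 ler_sqrt// ltr0n.
have s0 : 0 < s by lra.
have s2 : s ^+ 2 = n%:R by rewrite sqr_sqrtr// ler0n.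
have b30 : 0 < beta ^+ 3 by rewrite exprn_gt0.
have b31 : beta ^+ 3 <= 1 by rewrite exprn_ile1// ltW.
pose delta := beta ^+ 3 / 36.
have d0 : 0 < delta by rewrite divr_gt0.
have dn0 : 0 <= delta * n%:R by rewrite mulr_ge0 ?ler0n// ltW.
pose m := Num.truncn (delta * n%:R).
have /andP[m1 m2] := truncn_itv dn0; rewrite -/m in m1 m2.
have mn : m%:R <= n%:R :> R by apply: le_trans m1 _; rewrite ger_pMl ?ltr0n// /delta; lra.
have L0 : 0 < beta * s by rewrite mulr_gt0.
apply: le_trans (walk_max_ge n m L0).
have nm0 : (0 < n + m)%N by rewrite addn_gt0 n0.
have := abs_walk_sqrt nm0; rewrite ler_norml => /andP[lo _].
have p0 := pi_gt0 R.
have sq2 : 2^-1 <= Num.sqrt (2 / pi) :> R.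
  have pi4 : pi <= 4 :> R by have [/andP[_ h] _] := pihalf_02_cos_pihalf R; lra.
  have -> : (2^-1 : R) = Num.sqrt (2^-1 ^+ 2) by rewrite sqrtr_sqr ger0_norm.
  rewrite ler_sqrt ?divr_gt0// ler_pdivlMr//; lra.
have qE (z : R) : 0 <= z -> Num.sqrt (2 * z / pi) = Num.sqrt (2 / pi) * Num.sqrt z.
  by move=> z0; rewrite -sqrtrM ?divr_ge0 ?(ltW p0)//; congr Num.sqrt; rewrite mulrAC.
have mR : 0 <= m%:R :> R by rewrite ler0n.
rewrite qE ?ler0n// in lo; rewrite qE ?ler0n// -/s.
pose t := m%:R / s.
have t0 : 0 <= t by rewrite divr_ge0// ltW.
have mE : m%:R = t * s by rewrite divfK// gt_eqF.
have ts : t <= s by rewrite -(ler_pM2r s0) -mE -expr2 s2.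
have grow : s + t / 3 <= Num.sqrt (n + m)%:R.
  have st0 : 0 <= s + t / 3 by lra.
  rewrite -[leLHS]ger0_norm// -sqrtr_sqr ler_sqrt ?ltr0n// natrD -s2 mE.
  have := ler_wpM2l t0 ts; have := sqr_ge0 t; nra.
have td : t <= delta * s by rewrite -(ler_pM2r s0) -mE -mulrA -expr2 s2.
have td1 : delta * s - 1 <= t.
  have : delta * s * s <= t * s + 1 by rewrite -mE -mulrA -expr2 s2 natr1 ltW.
  move=> h; rewrite -(ler_pM2r s0); nra.
have err : 3 * m%:R ^+ 2 / (beta * s) ^+ 3 <= t / 12.
  rewrite mE (_ : 3 * _ / _ = t * (3 * t / (beta ^+ 3 * s))); last first.
    by field; rewrite !gt_eqF.
  rewrite ler_wpM2l// ler_pdivrMr ?mulr_gt0//.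
  have := ler_wpM2l (ler0n R 3) td; rewrite /delta; lra.
have cs : Num.sqrt (2 / pi) * s + t / 6 <= Num.sqrt (2 / pi) * Num.sqrt (n + m)%:R.
  have := ler_wpM2l (sqrtr_ge0 (2 / pi)) grow.
  have := ler_wpM2r t0 sq2; lra.
have dE : beta ^+ 3 * s / 432 = delta * s / 12 by rewrite /delta; field.
rewrite dE; lra.
Qed.

End WalkGain.

Section UniformWalk.
Context {R : realType}.

(** Under the uniform law the spins are the increments of a simple random walk. *)
Lemma uniform_mean_walk n (f : R -> R) (x : R) :
  uniform_mean (fun sigma : config n => f (x + \sum_i spin sigma i)) = walk n f x.
Proof.
rewrite /uniform_mean; elim: n x => [|n IHn] x.
  rewrite expr0 invr1 mul1r (eq_bigr (fun=> f x)) => [|sigma _]; last first.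
    by rewrite big_ord0 addr0.
  by rewrite sumr_const card_config.
pose join (p : bool * config n) : config n.+1 :=
  [ffun i => if unlift ord0 i is Some j then p.2 j else p.1].
rewrite (reindex join) /=; last first.
  exists (fun sigma : config n.+1 => (sigma ord0, [ffun j => sigma (lift ord0 j)])).
    move=> [b tau] _; rewrite /join ffunE unlift_none; congr (_, _).
    by apply/ffunP => j; rewrite !ffunE liftK.
  move=> sigma _; apply/ffunP => i; rewrite ffunE /=.
  by case: unliftP => [j ->|->]; rewrite ?ffunE.
rewrite (eq_bigr (fun p : bool * config n =>
    f (x + (if p.1 then 1 else -1) + \sum_i spin p.2 i))); last first.
  move=> [b tau] _; rewrite big_ord_recl addrA; congr f; congr (_ + _ + _).
    by rewrite /spin ffunE unlift_none.
  by apply: eq_bigr => i _; rewrite /spin ffunE liftK.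
rewrite -(pair_bigA _ (fun b tau => f (x + (if b then 1 else -1) + \sum_i spin tau i))).
rewrite big_bool /= -!IHn exprSr invfM; ring.
Qed.

Lemma uniform_meanD n (f g : config n -> R) :
  uniform_mean (fun sigma => f sigma + g sigma) = uniform_mean f + uniform_mean g.
Proof. by rewrite /uniform_mean big_split mulrDr. Qed.

Lemma uniform_meanZ n c (f : config n -> R) :
  uniform_mean (fun sigma => c * f sigma) = c * uniform_mean f.
Proof. by rewrite /uniform_mean -mulr_sumr mulrCA. Qed.

Lemma le_uniform_mean n (f g : config n -> R) :
  (forall sigma, f sigma <= g sigma) -> uniform_mean f <= uniform_mean g.
Proof.
move=> fg; rewrite /uniform_mean ler_pM2l ?invr_gt0 ?exprn_gt0//.
exact: ler_sum.
Qed.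

Lemma uniform_mean_cst n (c : R) : uniform_mean (fun _ : config n => c) = c.
Proof.
rewrite /uniform_mean sumr_const card_config -(mulr_natl c) natrX mulrA mulVf ?mul1r//.
Qed.

Lemma uniform_mean_spin2 n (i j : 'I_n) : i != j ->
  uniform_mean (fun sigma => spin sigma i * spin sigma j) = 0 :> R.
Proof.
move=> ij; set E := uniform_mean _; suff : E = - E by lra.
rewrite {1}/E /uniform_mean (reindex_inj (inv_inj (flipK (flip1 i)))) /=.
rewrite /E /uniform_mean -mulrN -sumrN; congr (_ * _); apply: eq_bigr => s _.
by rewrite !spin_flip !ffunE eqxx eq_sym (negbTE ij) expr1 expr0; ring.
Qed.

Lemma uniform_mean_magnetization2 n (A : {set 'I_n}) :
  uniform_mean (fun sigma => magnetization A sigma ^+ 2) = #|A|%:R :> R.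
Proof.
rewrite /uniform_mean; under eq_bigr do rewrite -sum_spinM.
rewrite exchange_big/= mulr_sumr -sumr_const; apply: eq_bigr => i iA.
rewrite exchange_big/= mulr_sumr (bigD1 i)//= [X in _ + X]big1 => [|j /andP[_ ji]].
  rewrite addr0 -[RHS](uniform_mean_cst n 1); congr (_ * _); apply: eq_bigr => s _.
  by rewrite /spin; case: (s i); ring.
by apply: uniform_mean_spin2; rewrite eq_sym.
Qed.

Lemma uniform_mean_abs_magnetization n (A : {set 'I_n}) : (0 < #|A|)%N ->
  uniform_mean (fun sigma => `|magnetization A sigma|) <= Num.sqrt #|A|%:R :> R.
Proof.
move=> A0; set c := Num.sqrt _; have c0 : 0 < c by rewrite sqrtr_gt0 ltr0n.
have c2 : c ^+ 2 = #|A|%:R by rewrite sqr_sqrtr// ler0n.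
apply: (@le_trans _ _ (uniform_mean (fun sigma : config n =>
    (2 * c)^-1 * magnetization A sigma ^+ 2 + c / 2))).
  apply: le_uniform_mean => sigma; set M := magnetization A sigma.
  rewrite -subr_ge0 -[M ^+ 2](real_normK (num_real M)).
  rewrite (_ : _ - _ = (2 * c)^-1 * (`|M| - c) ^+ 2); last by field; rewrite gt_eqF.
  by rewrite mulr_ge0 ?sqr_ge0// invr_ge0 mulr_ge0// ltW.
rewrite uniform_meanD uniform_meanZ uniform_mean_magnetization2 uniform_mean_cst -c2.
by rewrite le_eqVlt; apply/orP; left; apply/eqP; field; rewrite gt_eqF.
Qed.

End UniformWalk.

(** * The threshold interval of the critical regime *)

Section GaussianGap.
Context {R : realType}.
Implicit Types r z : R.
Local Notation lambda := (@lebesgue_measure R).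

Definition phi z : R := normal_pdf 0 1 z.

Lemma phiE z : phi z = (Num.sqrt (2 * pi))^-1 * expR (- z ^+ 2 / 2).
Proof.
rewrite /phi normal_pdfE ?oner_eq0// /normal_peak /normal_fun subr0 expr1n mul1r.
by rewrite (mulr_natl pi 2).
Qed.

Lemma phi_gt0 z : 0 < phi z.
Proof.
by rewrite phiE mulr_gt0 ?expR_gt0// invr_gt0 sqrtr_gt0 mulr_gt0// pi_gt0.
Qed.

Lemma integrable_phi (A : set R) : measurable A -> lambda.-integrable A (EFin \o phi).
Proof. by move=> mA; apply: (integrableS measurableT) => //; exact: integrable_normal_pdf. Qed.

Lemma is_derive_Phi z : is_derive z 1 Phi (phi z).
Proof.
have zz : z < z + 1 by rewrite ltrDl.
have iz := @integrable_phi [set` Interval -oo%O (BRight (z + 1))] (measurable_itv _).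
have cz : {for z, continuous phi} by apply: continuous_normal_pdf; exact: oner_neq0.
have [dP PE] := continuous_FTC1 zz iz (ltNyr z) cz.
by apply: DeriveDef; [exact: dP|rewrite -derive1E; exact: PE].
Qed.

Lemma is_derive_phi z : is_derive z 1 phi (- z * phi z).
Proof.
rewrite (_ : phi = fun z => (Num.sqrt (2 * pi))^-1 * expR (- z ^+ 2 / 2)); last first.
  by apply/funext => t; exact: phiE.
set c := (Num.sqrt _)^-1.
by apply: is_derive_eq; rewrite /GRing.scale /=; field.
Qed.

Lemma phiN z : phi (- z) = phi z.
Proof. by rewrite !phiE sqrrN. Qed.

Lemma Phi0 : Phi (0 : R) = 2^-1.
Proof.
have tot : \int[lambda]_x phi x = 1 by rewrite /Rintegral integral_normal_pdf.
have iT : lambda.-integrable [set` Interval -oo%O +oo%O] (EFin \o phi).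
  exact: integrable_phi.
have := Rintegral_itvB iT (isT : (-oo <= BRight (0 : R))%O) (isT : (BRight (0 : R) <= +oo)%O).
rewrite set_itvNyy tot Rintegral_itv_obnd_cbnd; last exact: integrable_phi.
have -> : \int[lambda]_(x in [set` Interval (BLeft 0) +oo%O]) phi x = 2^-1.
  have := @ge0_symfun_integralT R phi (normal_pdf_ge0 0 1)
    (continuous_normal_pdf (oner_neq0 R)) (fun x => esym (phiN x)).
  rewrite integral_normal_pdf.
  have fX : (\int[lambda]_(x in `[0%R, +oo[) (phi x)%:E)%E \is a fin_num.
    by apply: integrable_fin_num => //; exact: integrable_phi.
  rewrite -set_itvcy => /(congr1 fine); rewrite fineM//= /Rintegral; lra.
move=> h; change (\int[lambda]_(t in `]-oo, 0]) phi t = 2^-1); lra.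
Qed.

(** Both sides vanish at the origin, and two successive derivatives of their
    difference are nonnegative. The functions are abstract to be differentiated
    from the two hypotheses only. *)
Lemma folded_gap_of_derive (p G : R -> R) r :
  (forall z, is_derive z 1 p (- z * p z)) ->
  (forall z, is_derive z 1 G (- p z)) ->
  (forall z, 0 <= p z) -> 2 * G 0 = 1 -> 0 <= r ->
  r ^+ 2 * p r <= 2 * (p r - p 0) + r * (1 - 2 * G r).
Proof.
move=> dp dG p0 G0 r0.
pose K z : R := 1 - 2 * G z - 2 * (z * p z).
have dK z : is_derive z 1 K (2 * (z ^+ 2 * p z)).
  by have dpz := dp z; have dGz := dG z; apply: is_derive_eq; rewrite /GRing.scale /=; ring.
have K0 z : 0 <= z -> 0 <= K z.
  move=> z0; have := is_derive_ge0_le dK _ z0.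
  rewrite {1}/K G0 mul0r mulr0 !subrr; apply => t _.
  by apply: mulr_ge0 => //; apply: mulr_ge0 => //; exact: sqr_ge0.
pose H z : R := 2 * (p z - p 0) + z * (1 - 2 * G z) - z ^+ 2 * p z.
have dH z : is_derive z 1 H (K z + z ^+ 3 * p z).
  by have dpz := dp z; have dGz := dG z; apply: is_derive_eq; rewrite /GRing.scale /= /K; ring.
have := is_derive_ge0_le dH _ r0.
rewrite {1}/H expr0n /= subrr mulr0 !mul0r subr0 addr0 /H subr_ge0; apply.
move=> z /andP[/ltW z0 _]; apply: addr_ge0; first exact: K0.
by apply: mulr_ge0 => //; exact: exprn_ge0.
Qed.

(** A folded normal variable of location [r] has mean
    [2 * phi r + r * (1 - 2 * Phi (- r))], and its excess over the centred one is
    the integral of [2 * (r - u) * phi u] over [[0, r]]. *)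
Lemma folded_normal_gap r : 0 <= r ->
  r ^+ 2 * phi r <= 2 * (phi r - phi 0) + r * (1 - 2 * Phi (- r)).
Proof.
apply: (@folded_gap_of_derive phi (fun z => Phi (- z))).
- exact: is_derive_phi.
- move=> z; have dN : is_derive z 1 (fun t : R => - t) (-1) by apply: is_derive_eq.
  rewrite -phiN -[- phi _]mulrN1.
  exact: (is_derive1_comp (is_derive_Phi (- z)) dN).
- by move=> z; exact/ltW/phi_gt0.
- by rewrite oppr0 Phi0 divff// pnatr_eq0.
Qed.

Lemma sqrt_2Vpi : Num.sqrt (2 / pi) = 2 * phi 0 :> R.
Proof.
have p0 := pi_gt0 R.
rewrite phiE expr0n /= oppr0 mul0r expR0 mulr1.
have s0 : 0 < Num.sqrt (2 * pi) :> R by rewrite sqrtr_gt0 mulr_gt0.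
apply: (mulIf (lt0r_neq0 s0)); rewrite -mulrA mulVf ?gt_eqF// mulr1.
rewrite -sqrtrM ?divr_ge0 ?(ltW p0)// (_ : 2 / pi * _ = 2 ^+ 2).
  by rewrite sqrtr_sqr ger0_norm.
by rewrite mulrACA mulVf ?mulr1 ?gt_eqF.
Qed.

(** [Num.sqrt n / k] is the standard deviation of the rescaled walk, and [r] is [x] in
    this unit. *)
Definition threshold_gap (x : R) n k : R :=
  let r := x * k%:R / Num.sqrt n%:R in
  Num.sqrt n%:R / k%:R * (r ^+ 2 * phi r).

Lemma tau_lowerE n k : tau_lower n k = Num.sqrt (2 * n%:R / pi) / k%:R :> R.
Proof.
rewrite /tau_lower [pi * _]mulrC invfM mulrA mulrAC sqrtrM; last first.
  by rewrite divr_ge0 ?mulr_ge0 ?pi_ge0.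
by rewrite sqrtrV ?sqr_ge0// sqrtr_sqr ger0_norm.
Qed.

Lemma tau_upper_ge (x : R) n k : 0 < x -> (0 < k <= n)%N ->
  tau_lower n k + threshold_gap x n k <= tau_upper x n k.
Proof.
move=> x0 /andP[k0 kn]; have n0 : (0 < n)%N by exact: leq_trans kn.
have kR : 0 < k%:R :> R by rewrite ltr0n.
pose s : R := Num.sqrt n%:R; have s0 : 0 < s by rewrite sqrtr_gt0 ltr0n.
have s2 : s ^+ 2 = n%:R by rewrite sqr_sqrtr// ler0n.
have p0 := pi_gt0 R.
set r := x * k%:R / s; have r0 : 0 <= r by rewrite divr_ge0 ?mulr_ge0 ?(ltW x0)// ltW.
have sk0 : 0 < s / k%:R by rewrite divr_gt0.
have xE : x = s / k%:R * r by rewrite /r; field; rewrite !gt_eqF.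
have lowE : tau_lower n k = s / k%:R * (2 * phi 0).
  rewrite tau_lowerE -sqrt_2Vpi [RHS]mulrAC /s -sqrtrM ?ler0n//; congr (Num.sqrt _ / _).
  by rewrite mulrAC mulrC.
have upE : tau_upper x n k =
    s / k%:R * (2 * phi r) + x * (1 - 2 * Phi (- r)).
  rewrite /tau_upper -/s sqrt_2Vpi; congr (_ + _); last by rewrite /r mulNr.
  rewrite -mulrA; congr (_ * _); rewrite -mulrA; congr (_ * _).
  rewrite !phiE expr0n /= oppr0 mul0r expR0 mulr1; congr (_ * expR _).
  by rewrite -s2 /r; field; rewrite gt_eqF.
rewrite /threshold_gap -/s -/r lowE upE {1}xE -[s / k%:R * r * _]mulrA -!mulrDr.
rewrite ler_pM2l//; have := folded_normal_gap r0; lra.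
Qed.

End GaussianGap.

(** * The mean of the sum statistic under the planted law *)

Section PlantedMean.
Context {R : realType} (mu : probability (measurableTypeR R) R) (theta : R).
Hypothesis mean_tanh : \int[mu]_h tanh h = 0.
Variables (n : nat) (S : {set 'I_n}).
Hypothesis S_gt0 : (0 < #|S|)%N.

Local Notation k := (#|S|%:R : R).
Local Notation P := (planted_pmf mu theta S).

Let k_gt0 : 0 < k. Proof. by rewrite ltr0n. Qed.

Lemma sum_spin_split (sigma : config n) :
  \sum_i spin sigma i = magnetization S sigma + magnetization (~: S)%SET sigma :> R.
Proof.
rewrite (bigID (mem S)) /=; congr (_ + _); apply: eq_bigl => i.
by rewrite inE.
Qed.

Lemma mean_outside (f : config n -> R) :
  (forall sigma tau : config n, (forall i, i \notin S -> sigma i = tau i) ->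
    f sigma = f tau) -> mean P f = uniform_mean f.
Proof. exact: planted_mean_outside. Qed.

Lemma magnetization_outside (sigma tau : config n) :
  (forall i, i \notin S -> sigma i = tau i) ->
  magnetization (~: S)%SET sigma = magnetization (~: S)%SET tau :> R.
Proof.
by move=> st; apply: eq_bigr => i; rewrite inE /spin => iS; rewrite st.
Qed.

Lemma mean_outside_magnetization2 :
  mean P (fun sigma => magnetization (~: S)%SET sigma ^+ 2) <= n%:R.
Proof.
rewrite mean_outside => [|sigma tau st]; last by rewrite (magnetization_outside st).
by rewrite uniform_mean_magnetization2 ler_nat -[leqRHS]card_ord max_card.
Qed.

Lemma magnetization_le (sigma : config n) : `|magnetization S sigma| <= k.
Proof.
rewrite (le_trans (ler_norm_sum _ _ _))// -sumr_const ler_sum// => i _.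
by case: (spin_pm1 (R := R) sigma i) => ->; rewrite ?normrN normr1.
Qed.

Lemma le_mean (f g : config n -> R) : (forall sigma, f sigma <= g sigma) ->
  mean P f <= mean P g.
Proof. by move=> fg; apply: ler_sum => s _; rewrite ler_wpM2l// planted_pmf_ge0. Qed.

Lemma mean_cst (c : R) : mean P (fun=> c) = c.
Proof. by rewrite /mean -mulr_suml sum_planted_pmf mul1r. Qed.

Lemma mean_sqr_le : mean P (fun sigma => `|k^-1 * \sum_i spin sigma i| ^+ 2) <=
  2 * (n%:R / k ^+ 2) + 2.
Proof.
apply: (@le_trans _ _ (mean P (fun sigma =>
    2 / k ^+ 2 * magnetization (~: S)%SET sigma ^+ 2 + 2))).
  apply: le_mean => sigma; rewrite real_normK ?num_real// exprMn sum_spin_split.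
  have := magnetization_le sigma; set A := magnetization S sigma.
  set B := magnetization _ sigma => Ak.
  have A2 : A ^+ 2 <= k ^+ 2.
    by rewrite -[A ^+ 2]real_normK ?num_real// lerXn2r ?nnegrE// ltW.
  rewrite exprVn ler_pdivrMl ?exprn_gt0//.
  rewrite (_ : _ * (_ + 2) = 2 * B ^+ 2 + 2 * k ^+ 2); last by field; rewrite gt_eqF.
  have := sqr_ge0 (A - B); lra.
rewrite meanD meanZ mean_cst lerD2r mulrAC -mulrA ler_pM2l//.
by rewrite ler_pM2r ?invr_gt0 ?exprn_gt0//; exact: mean_outside_magnetization2.
Qed.

(** Flipping all the spins outside [S] preserves the planted law, so the mean of
    [`|T + W|], with [T] and [W] the contributions from [S] and its complement,
    is that of [Num.max `|T| `|W|]. Off the unlikely event of a low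
    magnetization, [`|T|] may be replaced by [eps], after which only the uniform
    spins outside [S] matter; completing them by uniform spins in [S] costs at most
    [(Num.sqrt k)^-1]. *)
Lemma mean_abs_ge (eps b q : R) : 0 < eps -> 0 < b ->
  \sum_(sigma | `|magnetization S sigma| <= eps * k) P sigma <= q ->
  uniform_mean (fun sigma : config n =>
      Num.max `|k^-1 * \sum_i spin sigma i| eps)
    - (Num.sqrt k)^-1 - b * (n%:R / k ^+ 2) - (eps + (4 * b)^-1) * q <=
  mean P (fun sigma => `|k^-1 * \sum_i spin sigma i|).
Proof.
move=> eps0 b0 lowq.
pose T sigma : R := k^-1 * magnetization S sigma.
pose W sigma : R := k^-1 * magnetization (~: S)%SET sigma.
have gE sigma : k^-1 * \sum_i spin sigma i = T sigma + W sigma.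
  by rewrite sum_spin_split mulrDr.
pose rho : config n := [ffun i => i \notin S].
have Tflip sigma : T (flip rho sigma) = T sigma.
  congr (_ * _); apply: eq_bigr => i iS.
  by rewrite spin_flip ffunE iS mul1r.
have Wflip sigma : W (flip rho sigma) = - W sigma.
  rewrite /W -mulrN; congr (_ * _); rewrite -sumrN; apply: eq_bigr => i.
  by rewrite inE => iS; rewrite spin_flip ffunE iS expr1 mulN1r.
have gmax : mean P (fun sigma => `|k^-1 * \sum_i spin sigma i|) =
    mean P (fun sigma => Num.max `|T sigma| `|W sigma|).
  set E := LHS; have E' : E = mean P (fun sigma => `|T sigma - W sigma|).
    rewrite /E /mean (reindex_inj (inv_inj (flipK rho))) /=.
    apply: eq_bigr => sigma _; rewrite planted_pmf_flip//.
      by rewrite gE Tflip Wflip.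
    by move=> i iS; rewrite ffunE iS.
  apply: (@mulfI _ 2); rewrite ?pnatr_eq0// mulr2n mulrDl mul1r {1}E' -meanD -meanZ.
  apply: eq_bigr => sigma _; congr (_ * _).
  by rewrite gE addrC normD_normB.
pose low sigma : R := if `|magnetization S sigma| <= eps * k then 1 else 0.
have lowE : mean P low = \sum_(sigma | `|magnetization S sigma| <= eps * k) P sigma.
  rewrite [RHS]big_mkcond; apply: eq_bigr => sigma _.
  by rewrite /low; case: ifP; rewrite ?mulr1 ?mulr0.
have step : mean P (fun sigma => Num.max `|W sigma| eps) <=
    mean P (fun sigma => Num.max `|T sigma| `|W sigma| +
      (b * W sigma ^+ 2 + (eps + (4 * b)^-1) * low sigma)).
  apply: le_mean => sigma; have W2 := sqr_ge0 (W sigma).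
  have bW : 0 <= b * W sigma ^+ 2 by rewrite mulr_ge0// ltW.
  rewrite /low; case: (leP `|magnetization S sigma|) => [_|hi].
    have amgm : `|W sigma| <= b * W sigma ^+ 2 + (4 * b)^-1.
      rewrite -[W sigma ^+ 2]real_normK ?num_real// -subr_ge0.
      rewrite (_ : _ - _ = b * (`|W sigma| - (2 * b)^-1) ^+ 2); last first.
        by field; rewrite gt_eqF.
      by rewrite mulr_ge0 ?sqr_ge0// ltW.
    have b4 : 0 <= (4 * b)^-1 by rewrite invr_ge0 mulr_ge0// ltW.
    have M0 : 0 <= Num.max `|T sigma| `|W sigma| by rewrite le_max normr_ge0.
    rewrite mulr1 ge_max; apply/andP; split; lra.
  rewrite mulr0 addr0 ler_wpDr// ge_max !le_max lexx orbT/=.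
  apply/orP; left; rewrite normrM gtr0_norm ?invr_gt0// ler_pdivlMl// mulrC.
  exact: ltW.
rewrite meanD meanD !meanZ lowE in step; rewrite gmax.
have outside : mean P (fun sigma => Num.max `|W sigma| eps) =
    uniform_mean (fun sigma => Num.max `|W sigma| eps).
  apply: mean_outside => sigma tau st.
  by rewrite /W (magnetization_outside st).
rewrite outside in step.
have W2le : mean P (fun sigma => W sigma ^+ 2) <= n%:R / k ^+ 2.
  rewrite (_ : mean P _ = k ^- 2 * mean P (fun sigma => magnetization (~: S)%SET sigma ^+ 2)).
    by rewrite mulrC ler_pM2r ?invr_gt0 ?exprn_gt0//; exact: mean_outside_magnetization2.
  by rewrite -meanZ; apply: eq_bigr => sigma _; rewrite /W exprMn exprVn.
have Tle : uniform_mean (fun sigma : config n => Num.max `|k^-1 * \sum_i spin sigma i| eps) <=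
    uniform_mean (fun sigma => Num.max `|W sigma| eps) + (Num.sqrt k)^-1.
  apply: (@le_trans _ _ (uniform_mean (fun sigma : config n =>
      Num.max `|W sigma| eps + k^-1 * `|magnetization S sigma|))).
    apply: le_uniform_mean => sigma; rewrite gE.
    have TE : k^-1 * `|magnetization S sigma| = `|T sigma|.
      by rewrite /T normrM gtr0_norm ?invr_gt0.
    rewrite TE ge_max; apply/andP; split.
      by rewrite addrC (le_trans (ler_normD _ _))// lerD2r le_max lexx.
    by rewrite ler_wpDr// le_max lexx orbT.
  rewrite uniform_meanD uniform_meanZ lerD2l.
  have := uniform_mean_abs_magnetization (R := R) S_gt0.
  have s0 : 0 < Num.sqrt k by rewrite sqrtr_gt0.
  rewrite -(ler_pM2l (x := k^-1)) ?invr_gt0// => /le_trans; apply.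
  have {1}-> : k = Num.sqrt k ^+ 2 by rewrite sqr_sqrtr// ltW.
  by rewrite expr2 invfM -mulrA mulVf ?mulr1// gt_eqF.
have c0 : 0 <= eps + (4 * b)^-1 by rewrite addr_ge0 ?invr_ge0 ?mulr_ge0// ltW.
have := ler_wpM2l c0 lowq; have := ler_wpM2l (ltW b0) W2le; lra.
Qed.

End PlantedMean.

(** * Large planted sets *)

Section Tests.
Context {R : realType} (mu : probability (measurableTypeR R) R) (theta : R).
Hypothesis mean_tanh : \int[mu]_h tanh h = 0.

Lemma null_pmf_ge0 n (sigma : config n) : 0 <= null_pmf mu sigma.
Proof. by rewrite (null_pmf_planted mu theta); exact: planted_pmf_ge0. Qed.

Lemma sum_null_pmf n : \sum_(sigma : config n) null_pmf mu sigma = 1.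
Proof.
by rewrite -[RHS](sum_planted_pmf mu theta (finset.set0 : {set 'I_n}));
  apply: eq_bigr => sigma _; rewrite (null_pmf_planted mu theta).
Qed.

Lemma null_meanE n (f : config n -> R) : mean (@null_pmf R mu n) f = uniform_mean f.
Proof. exact: null_mean. Qed.

Lemma asymptotically_powerfulP (n m : nat -> nat)
    (psi : forall k, pred (samples (n k) (m k))) :
  (forall e : R, 0 < e -> \forall k \near \oo,
     prod_prob (@null_pmf R mu (n k)) (psi k) <= e /\
     (forall S : {set 'I_(n k)}, #|S| = k ->
       prod_prob (planted_pmf mu theta S) (fun s => ~~ psi k s) <= e)) ->
  asymptotically_powerful mu theta psi.
Proof.
move=> small; apply/cvgrPdist_le => e e0.
have e20 : 0 < e / 2 by rewrite divr_gt0.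
near=> k.
have [null planted] : prod_prob (@null_pmf R mu (n k)) (psi k) <= e / 2 /\
     (forall S : {set 'I_(n k)}, #|S| = k ->
       prod_prob (planted_pmf mu theta S) (fun s => ~~ psi k s) <= e / 2).
  by near: k; exact: (small _ e20).
rewrite sub0r normrN /risk ger0_norm.
  rewrite (splitr e) lerD//; apply: bigmax_le => [|S /eqP Sk]; first exact: ltW.
  exact: planted.
rewrite addr_ge0 ?bigmax_ge_id//; apply: prod_prob_ge0; exact: null_pmf_ge0.
Unshelve. all: by end_near. Qed.

Lemma near_expr_le (rho e : R) : 0 < rho < 1 -> 0 < e ->
  \forall k \near \oo, rho ^+ k <= e.
Proof.
move=> /andP[r0 r1] e0.
have : (fun k => rho ^+ k) @ \oo --> (0 : R) by apply: cvg_expr; rewrite gtr0_norm.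
move=> /cvgrPdist_le /(_ e e0); apply: filterS => k.
by rewrite sub0r normrN ger0_norm// exprn_ge0// ltW.
Qed.

Lemma near_invr_le (e : R) : 0 < e -> \forall k \near \oo, k%:R^-1 <= e.
Proof.
move=> e0; near=> k.
have kr : e^-1 <= k%:R by near: k; exact: nbhs_infty_ger.
by rewrite -(invrK e) lef_pV2 ?posrE ?invr_gt0// (lt_le_trans _ kr)// invr_gt0.
Unshelve. all: by end_near. Qed.

Variables (eps rho : R).
Hypothesis eps_gt0 : 0 < eps.
Hypothesis rho01 : 0 < rho < 1.
Hypothesis low_magnetization : forall n (S : {set 'I_n}), (0 < #|S|)%N ->
  \sum_(sigma | `|magnetization S sigma| <= eps * #|S|%:R)
     planted_pmf mu theta S sigma <= rho ^+ #|S|.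

Let low n (S : {set 'I_n}) (sigma : config n) : R :=
  if `|magnetization S sigma| <= eps * #|S|%:R then 1 else 0.

Let low_ge0 n (S : {set 'I_n}) (sigma : config n) : 0 <= low S sigma.
Proof. by rewrite /low; case: ifP. Qed.

Let mean_low n (S : {set 'I_n}) : (0 < #|S|)%N ->
  mean (planted_pmf mu theta S) (low S) <= rho ^+ #|S|.
Proof.
move=> S0; apply: le_trans (low_magnetization S0); rewrite [leRHS]big_mkcond.
by apply: ler_sum => sigma _; rewrite /low; case: ifP; rewrite ?mulr1 ?mulr0.
Qed.

Lemma sum_test1_null n k (tau : R) : 0 < tau ->
  prod_prob (@null_pmf R mu n) (sum_test n 1 k tau) <= tau ^- 2 * (n%:R / k%:R ^+ 2).
Proof.
move=> t0; pose f (sigma : config n) : R :=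
  tau ^- 2 * (k%:R ^- 2 * magnetization finset.setT sigma ^+ 2).
apply: le_trans (prod_prob_markov (F := fun s => f (tnth s ord0)) _ _ _) _.
- exact: null_pmf_ge0.
- move=> s; apply: mulr_ge0; first by rewrite invr_ge0 sqr_ge0.
  by apply: mulr_ge0; rewrite ?invr_ge0 sqr_ge0.
- move=> s; rewrite /sum_test /phi4 invr1 mul1r big_ord1.
  set M := \sum_i _; have -> : f (tnth s ord0) = tau ^- 2 * `|k%:R^-1 * M| ^+ 2.
    rewrite /f real_normK ?num_real// exprMn exprVn /magnetization /M.
    by congr (_ * (_ * _ ^+ 2)); apply: eq_bigl => i; rewrite inE.
  move=> ltM; rewrite ler_pdivlMl ?exprn_gt0// mulr1 lerXn2r ?nnegrE ?(ltW t0)//.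
  exact: ltW.
rewrite sample_mean_coord ?sum_null_pmf// null_meanE /f !uniform_meanZ.
rewrite uniform_mean_magnetization2 cardsT card_ord [k%:R ^- 2 * _]mulrC.
by [].
Qed.

(** Acceptance forces either a low magnetization on [S] or a contribution of the other
    spins of at least [eps / 2]. *)
Lemma sum_test1_planted n (S : {set 'I_n}) (tau : R) : (0 < #|S|)%N ->
  tau <= eps / 2 ->
  prod_prob (planted_pmf mu theta S) (fun s => ~~ sum_test n 1 #|S| tau s) <=
  rho ^+ #|S| + 4 / eps ^+ 2 * (n%:R / #|S|%:R ^+ 2).
Proof.
move=> S0 te; have k0 : 0 < #|S|%:R :> R by rewrite ltr0n.
pose f (sigma : config n) : R := low S sigma +
  4 / eps ^+ 2 * (#|S|%:R ^- 2 * magnetization (~: S)%SET sigma ^+ 2).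
have e20 : 0 < 4 / eps ^+ 2 by rewrite divr_gt0// exprn_gt0.
have k2 : 0 <= #|S|%:R ^- 2 :> R by rewrite invr_ge0 exprn_ge0// ltW.
have tail0 (sigma : config n) : 0 <= 4 / eps ^+ 2 * (#|S|%:R ^- 2 * magnetization (~: S)%SET sigma ^+ 2).
  by rewrite mulr_ge0 ?(ltW e20)// mulr_ge0// sqr_ge0.
apply: le_trans (prod_prob_markov (F := fun s => f (tnth s ord0)) _ _ _) _.
- exact: planted_pmf_ge0.
- by move=> s; rewrite addr_ge0.
- move=> s; rewrite /sum_test /phi4 invr1 mul1r big_ord1 -leNgt.
  rewrite (sum_spin_split S) mulrDr /f /low.
  case: (leP `|magnetization S (tnth s ord0)|) => [_ _|hi small].
    by rewrite lerDl.
  rewrite add0r -exprVn -exprMn; move: small.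
  set T := _ * magnetization S _; set W := _ * magnetization _ _ => small.
  have Te : eps <= `|T|.
    by rewrite /T normrM gtr0_norm ?invr_gt0// ler_pdivlMl// mulrC ltW.
  have We : eps / 2 <= `|W|.
    have := ler_normB (T + W) W; rewrite addrK; lra.
  rewrite mulrAC ler_pdivlMr ?exprn_gt0// mul1r.
  have -> : 4 * W ^+ 2 = (2 * `|W|) ^+ 2.
    by rewrite [RHS]exprMn real_normK ?num_real//; ring.
  by rewrite lerXn2r ?nnegrE ?(ltW eps_gt0)//; lra.
rewrite sample_mean_coord ?sum_planted_pmf// meanD !meanZ lerD ?mean_low//.
rewrite ler_pM2l// mulrC ler_wpM2r//; exact: mean_outside_magnetization2.
Qed.

Lemma powerful_large_k (tau : R) : 0 < tau <= eps / 2 -> forall n : nat -> nat,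
  (fun k => Num.sqrt (n k)%:R : R^o) =o_\oo (fun k => k%:R : R^o) ->
  asymptotically_powerful mu theta (fun k => sum_test (n k) 1 k tau).
Proof.
move=> /andP[t0 te] n no; apply: asymptotically_powerfulP => e e0.
pose c := Num.min (tau ^+ 2) (eps ^+ 2 / 4) * (e / 2).
have c0 : 0 < c by rewrite mulr_gt0 ?divr_gt0// lt_min exprn_gt0//= divr_gt0// exprn_gt0.
near=> k; have k0 : (0 < k)%N by near: k; exact: nbhs_infty_gt.
have kR : 0 < k%:R :> R by rewrite ltr0n.
have ratio : (n k)%:R / k%:R ^+ 2 <= c.
  have : `|Num.sqrt (n k)%:R : R^o| <= Num.sqrt c * `|k%:R : R^o|.
    near: k; move/eqoP: no; apply; by rewrite sqrtr_gt0.
  rewrite !ger0_norm ?sqrtr_ge0 ?(ltW kR)// => H.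
  rewrite ler_pdivrMr ?exprn_gt0// -(sqr_sqrtr (ltW c0)) -exprMn.
  by rewrite -[leLHS]sqr_sqrtr ?ler0n// lerXn2r ?nnegrE ?mulr_ge0 ?sqrtr_ge0 ?(ltW kR).
have small : rho ^+ k <= e / 2 by near: k; apply: near_expr_le; rewrite ?divr_gt0.
split.
  apply: le_trans (sum_test1_null _ _ t0) _.
  rewrite ler_pdivrMl ?exprn_gt0//; apply: le_trans ratio _.
  rewrite /c; apply: (@le_trans _ _ (tau ^+ 2 * (e / 2))).
    by rewrite ler_wpM2r ?divr_ge0 ?(ltW e0)// ge_min lexx.
  by rewrite ler_wpM2l ?sqr_ge0//; lra.
move=> S Sk; have S0 : (0 < #|S|)%N by rewrite Sk.
have := sum_test1_planted S0 te; rewrite !Sk => /le_trans; apply.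
rewrite (splitr e) lerD// -ler_pdivlMl ?divr_gt0 ?exprn_gt0//.
apply: le_trans ratio _; rewrite /c invf_div ler_wpM2r ?divr_ge0 ?(ltW e0)//.
by rewrite ge_min lexx orbT.
Unshelve. all: by end_near. Qed.

End Tests.

(** * Planted sets of order [Num.sqrt n] *)

Section CriticalRegime.
Context {R : realType} (mu : probability (measurableTypeR R) R) (theta : R).
Hypothesis mean_tanh : \int[mu]_h tanh h = 0.
Variables (eps rho x : R).
Hypothesis eps_gt0 : 0 < eps.
Hypothesis rho01 : 0 < rho < 1.
Hypothesis low_magnetization : forall n (S : {set 'I_n}), (0 < #|S|)%N ->
  \sum_(sigma | `|magnetization S sigma| <= eps * #|S|%:R)
     planted_pmf mu theta S sigma <= rho ^+ #|S|.
Hypothesis x_gt0 : 0 < x.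

(** The gain of [walk_max_gain], rescaled, for the largest admissible [beta] such that
    [beta * Num.sqrt n <= eps * k]. *)
Definition walk_gap n k : R :=
  Num.min 1 (eps * k%:R / Num.sqrt n%:R) ^+ 3 * Num.sqrt n%:R / (432 * k%:R).

Definition critical_threshold n k : R :=
  tau_lower n k + Num.min (threshold_gap x n k) (walk_gap n k) / 2.

Lemma uniform_mean_abs_sum n k : (0 < k)%N ->
  uniform_mean (fun sigma : config n => `|k%:R^-1 * \sum_i spin sigma i|) =
  abs_walk n / k%:R :> R.
Proof.
move=> k0; rewrite -[LHS](_ : uniform_mean (fun sigma : config n =>
    (fun y => k%:R^-1 * `|y|) (0 + \sum_i spin sigma i)) = _).
  by rewrite (uniform_mean_walk n (fun y => k%:R^-1 * `|y|)) walkZ mulrC.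
congr uniform_mean; apply/funext => sigma /=.
by rewrite add0r normrM ger0_norm// invr_ge0 ler0n.
Qed.

Lemma uniform_mean_max_ge n k : (0 < n)%N -> (0 < k)%N ->
  tau_lower n k + walk_gap n k - 2 / k%:R <=
  uniform_mean (fun sigma : config n => Num.max `|k%:R^-1 * \sum_i spin sigma i| eps).
Proof.
move=> n0 k0; have kR : 0 < k%:R :> R by rewrite ltr0n.
have s0 : 0 < Num.sqrt n%:R :> R by rewrite sqrtr_gt0 ltr0n.
rewrite -[leRHS](_ : uniform_mean (fun sigma : config n =>
    (fun y => k%:R^-1 * Num.max `|y| (eps * k%:R)) (0 + \sum_i spin sigma i)) = _); last first.
  congr uniform_mean; apply/funext => sigma /=.
  rewrite add0r maxr_pMr ?invr_ge0 ?ler0n// normrM ger0_norm ?invr_ge0 ?ler0n//.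
  by congr Num.max; rewrite mulrC mulfK// gt_eqF.
rewrite (uniform_mean_walk n (fun y => k%:R^-1 * Num.max `|y| (eps * k%:R))) walkZ.
rewrite ler_pdivlMl//.
pose beta : R := Num.min 1 (eps * k%:R / Num.sqrt n%:R).
have b0 : 0 < beta by rewrite lt_min ltr01 divr_gt0// mulr_gt0.
have b1 : beta <= 1 by rewrite ge_min lexx.
have bL : beta * Num.sqrt n%:R <= eps * k%:R.
  by rewrite -ler_pdivlMr// ge_min lexx orbT.
apply: (@le_trans _ _ (walk n (fun y => Num.max `|y| (beta * Num.sqrt n%:R)) 0)).
  have b01 : 0 < beta <= 1 by rewrite b0 b1.
  apply: le_trans (walk_max_gain n0 b01).
  rewrite tau_lowerE /walk_gap -/beta le_eqVlt; apply/orP; left; apply/eqP.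
  by field; rewrite gt_eqF.
by apply: le_walk => y; rewrite ge_max !le_max lexx bL orbT.
Qed.

Lemma sum_test_null n m k (tau eta : R) : (0 < n)%N -> (0 < k)%N -> (0 < m)%N ->
  0 < eta -> tau_lower n k + k%:R^-1 + eta <= tau ->
  prod_prob (@null_pmf R mu n) (sum_test n m k tau) <=
  n%:R / k%:R ^+ 2 / (m%:R * eta ^+ 2).
Proof.
move=> n0 k0 m0 eta0 tau_ge; have kR : 0 < k%:R :> R by rewrite ltr0n.
have mg : mean (@null_pmf R mu n) (fun sigma => `|k%:R^-1 * \sum_i spin sigma i|) <=
    tau_lower n k + k%:R^-1.
  rewrite (null_meanE theta mean_tanh) uniform_mean_abs_sum// tau_lowerE.
  rewrite -[X in _ + X]mul1r -mulrDl ler_pM2r ?invr_gt0//.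
  by have := abs_walk_sqrt (R := R) n0; rewrite ler_norml => /andP[_]; lra.
apply: le_trans (prod_prob_chebyshev (g := fun sigma =>
  `|k%:R^-1 * \sum_i spin sigma i|) _ _ m0 eta0 _) _.
- exact: (null_pmf_ge0 mu theta).
- exact: (sum_null_pmf mu theta).
- move=> s; rewrite /sum_test /phi4 => lt_tau.
  by rewrite (le_trans _ (ler_norm _))//; lra.
rewrite ler_pM2r ?invr_gt0 ?mulr_gt0 ?exprn_gt0 ?ltr0n// (null_meanE theta mean_tanh).
have -> : uniform_mean (fun sigma : config n => `|k%:R^-1 * \sum_i spin sigma i| ^+ 2) =
    k%:R ^- 2 * uniform_mean (fun sigma : config n => magnetization finset.setT sigma ^+ 2) :> R.
  rewrite -uniform_meanZ; congr uniform_mean; apply/funext => sigma.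
  rewrite real_normK ?num_real// exprMn exprVn; congr (_ * _ ^+ 2).
  by apply: eq_bigl => i; rewrite inE.
by rewrite uniform_mean_magnetization2 cardsT card_ord mulrC.
Qed.

Lemma sum_test_planted n m (S : {set 'I_n}) (tau eta b : R) :
  (0 < #|S|)%N -> (0 < m)%N -> 0 < eta -> 0 < b ->
  tau + eta <= tau_lower n #|S| + walk_gap n #|S| - 2 / #|S|%:R
    - (Num.sqrt #|S|%:R)^-1 - b * (n%:R / #|S|%:R ^+ 2)
    - (eps + (4 * b)^-1) * rho ^+ #|S| ->
  prod_prob (planted_pmf mu theta S) (fun s => ~~ sum_test n m #|S| tau s) <=
  (2 * (n%:R / #|S|%:R ^+ 2) + 2) / (m%:R * eta ^+ 2).
Proof.
move=> S0 m0 eta0 b0 tau_le.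
have n0 : (0 < n)%N.
  by apply: leq_trans S0 _; rewrite -[leqRHS]card_ord max_card.
have := mean_abs_ge mean_tanh S0 eps_gt0 b0 (low_magnetization S0).
have := uniform_mean_max_ge n0 S0.
set U := uniform_mean _; set M := mean _ _ => U_ge M_ge.
apply: le_trans (prod_prob_chebyshev (g := fun sigma =>
  `|#|S|%:R^-1 * \sum_i spin sigma i|) _ _ m0 eta0 _) _.
- exact: planted_pmf_ge0.
- exact: sum_planted_pmf.
- move=> s; rewrite /sum_test /phi4 -leNgt -/M => le_tau.
  by rewrite distrC (le_trans _ (ler_norm _))//; lra.
rewrite ler_pM2r ?invr_gt0 ?mulr_gt0 ?exprn_gt0 ?ltr0n//.
exact: mean_sqr_le.
Qed.

Lemma threshold_gap_gt0 n k : (0 < k <= n)%N -> 0 < threshold_gap x n k.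
Proof.
move=> /andP[k0 kn]; have n0 := leq_trans k0 kn.
have s0 : 0 < Num.sqrt n%:R :> R by rewrite sqrtr_gt0 ltr0n.
have kR : 0 < k%:R :> R by rewrite ltr0n.
rewrite /threshold_gap mulr_gt0 ?divr_gt0// mulr_gt0 ?phi_gt0//.
by rewrite exprn_gt0// divr_gt0// mulr_gt0.
Qed.

Lemma walk_gap_gt0 n k : (0 < k <= n)%N -> 0 < walk_gap n k.
Proof.
move=> /andP[k0 kn]; have n0 := leq_trans k0 kn.
have s0 : 0 < Num.sqrt n%:R :> R by rewrite sqrtr_gt0 ltr0n.
have kR : 0 < k%:R :> R by rewrite ltr0n.
have c0 : 0 < 432 * k%:R :> R by apply: mulr_gt0; [rewrite ltr0n|exact: kR].
apply: mulr_gt0; last by rewrite invr_gt0.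
apply: mulr_gt0 => //; apply: exprn_gt0.
by rewrite lt_min ltr01 divr_gt0// mulr_gt0.
Qed.

Lemma critical_threshold_itv n k : (0 < k <= n)%N ->
  tau_lower n k < critical_threshold n k < tau_upper x n k.
Proof.
move=> kn; have g0 := threshold_gap_gt0 kn; have w0 := walk_gap_gt0 kn.
have up := tau_upper_ge x_gt0 kn; rewrite /critical_threshold.
have m0 : 0 < Num.min (threshold_gap x n k) (walk_gap n k) by rewrite lt_min g0.
have mg : Num.min (threshold_gap x n k) (walk_gap n k) <= threshold_gap x n k.
  by rewrite ge_min lexx.
apply/andP; split; lra.
Qed.

Lemma phi_le (r z : R) : 0 <= r <= z -> phi z <= phi r.
Proof.
move=> /andP[r0 rz]; rewrite !phiE ler_wpM2l ?invr_ge0 ?sqrtr_ge0//.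
rewrite ler_expR ler_pM2r ?invr_gt0// lerN2 lerXn2r ?nnegrE//.
exact: le_trans rz.
Qed.

(** Every factor of the two gaps is monotone in [Num.sqrt n / k], hence at least its
    value at one of the endpoints. *)
Lemma critical_gap_ge (C : R) : 0 < C -> exists2 w : R, 0 < w &
  forall n k, (0 < k <= n)%N -> C^-1 <= Num.sqrt n%:R / k%:R <= C ->
  w <= Num.min (threshold_gap x n k) (walk_gap n k).
Proof.
move=> C0; have CV0 : 0 < C^-1 by rewrite invr_gt0.
have c432 : 0 < 432^-1 :> R by rewrite invr_gt0 ltr0n.
exists (Num.min (C^-1 * ((x / C) ^+ 2 * phi (x * C)))
  (Num.min 1 (eps / C) ^+ 3 * C^-1 / 432)).
  rewrite lt_min; apply/andP; split.
    apply: mulr_gt0 => //; apply: mulr_gt0; last exact: phi_gt0.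
    by apply: exprn_gt0; rewrite divr_gt0.
  apply: mulr_gt0; last exact: c432.
  apply: mulr_gt0; last exact: CV0.
  by apply: exprn_gt0; rewrite lt_min ltr01 divr_gt0.
move=> n k /andP[k0 kn]; set y := _ / _ => /andP[yC Cy].
have n0 := leq_trans k0 kn.
have s0 : 0 < Num.sqrt n%:R :> R by rewrite sqrtr_gt0 ltr0n.
have kR : 0 < k%:R :> R by rewrite ltr0n.
have y0 : 0 < y by rewrite divr_gt0.
have yV : k%:R / Num.sqrt n%:R = y^-1 by rewrite invf_div.
have CVy : C^-1 <= y^-1 by rewrite lef_pV2 ?posrE.
have yVC : y^-1 <= C by rewrite -(invrK C) lef_pV2 ?posrE.
rewrite le_min; apply/andP; split.
  rewrite ge_min; apply/orP; left; rewrite /threshold_gap -/y -mulrA yV.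
  have r0 : 0 <= x / C by rewrite divr_ge0 ?ltW.
  have rr : x / C <= x * y^-1 by rewrite ler_pM2l.
  apply: ler_pM => //; first exact: ltW.
    by rewrite mulr_ge0 ?sqr_ge0// ltW// phi_gt0.
  apply: ler_pM; rewrite ?sqr_ge0 ?(ltW (phi_gt0 _))//.
    by rewrite lerXn2r ?nnegrE// (le_trans r0).
  by apply: phi_le; rewrite (le_trans r0 rr) ler_pM2l.
rewrite ge_min; apply/orP; right.
have -> : walk_gap n k =
    Num.min 1 (eps * k%:R / Num.sqrt n%:R) ^+ 3 * (y / 432).
  by rewrite /walk_gap /y; field; rewrite gt_eqF.
rewrite -[leLHS]mulrA; apply: ler_pM.
- by rewrite exprn_ge0// le_min ler01 divr_ge0// ltW.
- exact: (mulr_ge0 (ltW CV0) (ltW c432)).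
- have b0 : 0 <= Num.min 1 (eps / C) by rewrite le_min ler01 divr_ge0// ltW.
  have bb : Num.min 1 (eps / C) <= Num.min 1 (eps * k%:R / Num.sqrt n%:R).
    rewrite le_min !ge_min lexx /= -mulrA yV; apply/orP; right.
    by rewrite ler_pM2l.
  by rewrite lerXn2r ?nnegrE// (le_trans b0).
- by rewrite (ler_pM2r c432).
Qed.

Lemma near_ler_nat (a : R) (m : nat -> nat) :
  (fun=> 1 : R^o) =o_\oo (fun k => (m k)%:R : R^o) ->
  \forall k \near \oo, a <= (m k)%:R.
Proof.
move=> mo; pose c := (`|a| + 1)^-1; have c0 : 0 < c by rewrite invr_gt0 ltr_wpDl.
near=> k; have : `|1 : R^o| <= c * `|(m k)%:R : R^o|.
  by near: k; move/eqoP: mo; exact.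
rewrite normr1 ger0_norm ?ler0n// /c ler_pdivlMl ?ltr_wpDl// mulr1.
by apply: le_trans; rewrite ler_wpDr// ler_norm.
Unshelve. all: by end_near. Qed.

Lemma near_sqrtV_le (e : R) : 0 < e -> \forall k \near \oo, (Num.sqrt k%:R)^-1 <= e.
Proof.
move=> e0; have e20 : 0 < e ^+ 2 by rewrite exprn_gt0.
near=> k; have : k%:R^-1 <= e ^+ 2 by near: k; exact: near_invr_le.
have k0 : (0 < k)%N by near: k; exact: nbhs_infty_gt.
have s0 : 0 < Num.sqrt k%:R :> R by rewrite sqrtr_gt0 ltr0n.
rewrite -{1}(sqr_sqrtr (ler0n R k)) -exprVn => H.
by rewrite -(@ler_pXn2r _ 2) ?nnegrE ?invr_ge0 ?(ltW s0) ?(ltW e0).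
Unshelve. all: by end_near. Qed.

Lemma powerful_critical (n m : nat -> nat) :
  (forall k, (k <= n k)%N) -> (forall k, (0 < m k)%N) ->
  (fun k => k%:R : R^o) =Theta_\oo (fun k => Num.sqrt (n k)%:R : R^o) ->
  (fun=> 1 : R^o) =o_\oo (fun k => (m k)%:R : R^o) ->
  asymptotically_powerful mu theta
    (fun k => sum_test (n k) (m k) k (critical_threshold (n k) k)).
Proof.
move=> kn m0 kTheta mo.
have [C C0 ratio] : exists2 C : R, 0 < C & \forall k \near \oo,
    C^-1 <= Num.sqrt (n k)%:R / k%:R <= C.
  move: kTheta; rewrite eqThetaE => /asboolP[[a b] /= /andP[a0 b0] near_ab].
  exists (Num.max a^-1 b); first by rewrite lt_max b0 orbT.
  near=> k; have k0 : (0 < k)%N by near: k; exact: nbhs_infty_gt.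
  have kR : 0 < k%:R :> R by rewrite ltr0n.
  have [lo hi] : a * `|Num.sqrt (n k)%:R : R^o| <= `|k%:R : R^o| /\
      `|k%:R : R^o| <= b * `|Num.sqrt (n k)%:R : R^o| by near: k.
  rewrite !ger0_norm ?sqrtr_ge0 ?(ltW kR)// in lo hi.
  have m_gt0 : 0 < Num.max a^-1 b by rewrite lt_max b0 orbT.
  apply/andP; split.
    rewrite ler_pdivlMr// ler_pdivrMl//; apply: le_trans hi _.
    by rewrite ler_wpM2r ?sqrtr_ge0// le_max lexx orbT.
  rewrite ler_pdivrMr//; apply: (@le_trans _ _ (a^-1 * k%:R)).
    by rewrite ler_pdivlMl.
  by rewrite ler_pM2r// le_max lexx.
have [w w0 gap] := critical_gap_ge C0.
have bounds (r c : R) : 0 < c -> r <= c -> r <= 2 * c + 2 /\ 2 * r + 2 <= 2 * c + 2.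
  by move=> ? ?; split; lra.
have null_margin (t g kV : R) : w <= g -> kV <= w / 32 -> t + kV + w / 4 <= t + g / 2.
  lra.
have planted_margin (t g g' kV sV u v : R) : w <= g -> g <= g' -> kV <= w / 32 ->
    sV <= w / 16 -> u <= w / 16 -> v <= w / 16 ->
    t + g / 2 + w / 4 <= t + g' - 2 * kV - sV - u - v.
  lra.
pose b := w / (16 * C ^+ 2); have b0 : 0 < b by rewrite divr_gt0// mulr_gt0// exprn_gt0.
have c0 : 0 < eps + (4 * b)^-1 by rewrite addr_gt0// invr_gt0 mulr_gt0.
have w4 : 0 < w / 4 by rewrite divr_gt0.
apply: asymptotically_powerfulP => // e e0.
near=> k; have k0 : (0 < k)%N by near: k; exact: nbhs_infty_gt.
have kR : 0 < k%:R :> R by rewrite ltr0n.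
have n0 : (0 < n k)%N := leq_trans k0 (kn k).
have kkn : (0 < k <= n k)%N by rewrite k0 kn.
have rk : C^-1 <= Num.sqrt (n k)%:R / k%:R <= C by near: k.
have gk := gap _ _ kkn rk.
have nk : (n k)%:R / k%:R ^+ 2 <= C ^+ 2.
  rewrite -[X in X / _](sqr_sqrtr (ler0n R (n k))) -expr_div_n.
  have y0 : 0 <= Num.sqrt (n k)%:R / k%:R :> R.
    by apply: divr_ge0; [exact: sqrtr_ge0|exact: ltW].
  case/andP: rk => _ rk; rewrite lerXn2r// nnegrE; exact: ltW.
have kV : k%:R^-1 <= w / 32 by near: k; apply: near_invr_le; rewrite divr_gt0.
have sV : (Num.sqrt k%:R)^-1 <= w / 16 by near: k; apply: near_sqrtV_le; rewrite divr_gt0.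
have rhok : rho ^+ k <= w / 16 / (eps + (4 * b)^-1).
  by near: k; apply: near_expr_le => //; rewrite !divr_gt0.
have mk : (2 * C ^+ 2 + 2) / ((w / 4) ^+ 2 * e) <= (m k)%:R.
  by near: k; exact: near_ler_nat.
have mR : 0 < (m k)%:R :> R by rewrite ltr0n.
have final (A : R) : A <= 2 * C ^+ 2 + 2 -> A / ((m k)%:R * (w / 4) ^+ 2) <= e.
  have w2 : 0 < (w / 4) ^+ 2 by rewrite exprn_gt0.
  move=> Ale; rewrite (ler_pdivrMr _ _ (mulr_gt0 mR w2)); apply: (le_trans Ale).
  rewrite (_ : e * _ = (m k)%:R * ((w / 4) ^+ 2 * e)); last by ring.
  by move: mk; rewrite (ler_pdivrMr _ _ (mulr_gt0 w2 e0)).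
have C20 : 0 < C ^+ 2 by rewrite exprn_gt0.
have mg : Num.min (threshold_gap x (n k) k) (walk_gap (n k) k) <= walk_gap (n k) k.
  by rewrite ge_min lexx orbT.
have nkC : (n k)%:R / k%:R ^+ 2 <= 2 * C ^+ 2 + 2.
  by have [] := bounds _ _ C20 nk.
have nkC2 : 2 * ((n k)%:R / k%:R ^+ 2) + 2 <= 2 * C ^+ 2 + 2.
  by have [] := bounds _ _ C20 nk.
set G := Num.min _ _ in gk mg; set D := walk_gap _ _ in mg.
split.
  apply: (le_trans (sum_test_null n0 k0 (m0 k) w4 _) (final _ nkC)).
  rewrite /critical_threshold -/G; exact: null_margin.
move=> S Sk; have S0 : (0 < #|S|)%N by rewrite Sk.
have := @sum_test_planted _ (m k) S (critical_threshold (n k) k) (w / 4) b S0 (m0 k) w4 b0.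
rewrite !Sk => main; apply: (le_trans (main _) (final _ nkC2)).
have bn : b * ((n k)%:R / k%:R ^+ 2) <= w / 16.
  apply: le_trans (ler_wpM2l (ltW b0) nk) _; rewrite /b.
  by rewrite le_eqVlt; apply/orP; left; apply/eqP; field; rewrite gt_eqF.
have rr : (eps + (4 * b)^-1) * rho ^+ k <= w / 16.
  by rewrite mulrC -ler_pdivlMr.
rewrite /critical_threshold -/G -/D.
exact: planted_margin.
Unshelve. all: by end_near. Qed.

End CriticalRegime.

(** * Small planted sets *)

Section ScanTest.
Context {R : realType} (mu : probability (measurableTypeR R) R) (theta : R).
Hypothesis mean_tanh : \int[mu]_h tanh h = 0.

Lemma cosh_le (t : R) : 0 <= t <= 2^-1 -> cosh t <= expR (3 / 4 * t ^+ 2).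
Proof.
move=> t01; have hi := expR_le_cubic_ge0 t01; case/andP: t01 => t0 t1.
have lo := expRN_le_quadratic t0; apply: le_trans (expR_ge1Dx _).
have t3 : t ^+ 3 <= t ^+ 2 / 2 by rewrite exprSr ler_wpM2l ?sqr_ge0.
rewrite /cosh; lra.
Qed.

Lemma coshN (t : R) : cosh (- t) = cosh t.
Proof. by rewrite /cosh opprK addrC. Qed.

Lemma cosh0 : cosh (0 : R) = 1.
Proof. by rewrite /cosh oppr0 expR0; field. Qed.

Lemma uniform_mean_expR n (S : {set 'I_n}) (t : R) :
  uniform_mean (fun sigma => expR (t * magnetization S sigma)) = cosh t ^+ #|S|.
Proof.
have -> : (fun sigma : config n => expR (t * magnetization S sigma)) =
    fun sigma => expR (\sum_i (if i \in S then t else 0) * spin sigma i).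
  apply/funext => sigma; rewrite /magnetization mulr_sumr big_mkcond.
  by congr expR; apply: eq_bigr => i _; case: ifP; rewrite ?mul0r.
rewrite /uniform_mean sum_expR_field big_split prodr_const card_ord /=.
rewrite mulrA mulVf ?mul1r ?expf_neq0 ?pnatr_eq0// -prodr_const [RHS]big_mkcond.
by apply: eq_bigr => i _; case: ifP => // _; rewrite cosh0.
Qed.

Lemma uniform_mean_expR_abs n (S : {set 'I_n}) (t : R) : 0 <= t <= 2^-1 ->
  uniform_mean (fun sigma => expR (t * `|magnetization S sigma|)) <=
  2 * expR (3 / 4 * t ^+ 2 * #|S|%:R).
Proof.
move=> t01; apply: (@le_trans _ _ (2 * cosh t ^+ #|S|)); last first.
  rewrite ler_pM2l// mulrC expRM_natl lerXn2r ?nnegrE ?expR_ge0//.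
    exact/ltW/cosh_gt0.
  exact: cosh_le.
rewrite mulr2n mulrDl mul1r -[X in _ + X ^+ _]coshN -!uniform_mean_expR.
rewrite -uniform_meanD; apply: le_uniform_mean => sigma.
case: (ger0P (magnetization S sigma)) => _; first by rewrite lerDl expR_ge0.
by rewrite mulrN -mulNr lerDr expR_ge0.
Qed.

(** Exponential Chebyshev inequality with parameter [tau], for the sum over the samples
    of the absolute magnetizations of [S]; the factor [2] accounts for the two
    signs. *)
Lemma phi_set_null n m k (S : {set 'I_n}) (tau : R) :
  #|S| = k -> (0 < k)%N -> (0 < m)%N -> 0 < tau <= 2^-1 ->
  prod_prob (@null_pmf R mu n) (fun s : samples n m => tau <= phi_set k S s) <=
  (2 * expR (- (tau ^+ 2 * k%:R / 4))) ^+ m.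
Proof.
move=> Sk k0 m0 /andP[t0 t1]; have kR : 0 < k%:R :> R by rewrite ltr0n.
have mR : 0 < m%:R :> R by rewrite ltr0n.
pose g (sigma : config n) : R := expR (tau * `|magnetization S sigma| - tau ^+ 2 * k%:R).
apply: le_trans (prod_prob_markov (F := fun s => \prod_j g (tnth s j)) _ _ _) _.
- exact: (null_pmf_ge0 mu theta).
- by move=> s; apply: prodr_ge0 => j _; exact: expR_ge0.
- move=> s; rewrite /phi_set => hs; rewrite -expR_sum -[leLHS]expR0 ler_expR.
  rewrite sumrB sumr_const card_ord -mulr_sumr subr_ge0.
  move: hs; rewrite (eq_bigr (fun j => k%:R^-1 * `|magnetization S (tnth s j)|)); last first.
    by move=> j _; rewrite normrM ger0_norm// invr_ge0 ltW.
  rewrite -mulr_sumr mulrA -invfM ler_pdivlMl ?mulr_gt0// => hs.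
  rewrite -(mulr_natl (_ * _)); have := ler_wpM2l (ltW t0) hs.
  by rewrite expr2 (_ : m%:R * (tau * tau * _) = tau * (m%:R * k%:R * tau))//; ring.
rewrite (sample_mean_prod _ (fun=> g)) prodr_const card_ord.
have g0 : 0 <= mean (@null_pmf R mu n) g.
  apply: sumr_ge0 => s _; rewrite mulr_ge0 ?expR_ge0//; exact: (null_pmf_ge0 mu theta).
rewrite lerXn2r ?nnegrE ?mulr_ge0 ?expR_ge0// (null_meanE theta mean_tanh).
have -> : g = fun sigma => expR (- (tau ^+ 2 * k%:R)) *
    expR (tau * `|magnetization S sigma|).
  by apply/funext => sigma; rewrite -expRD addrC.
have t01 : 0 <= tau <= 2^-1 by rewrite ltW.
rewrite uniform_meanZ; apply: le_trans (ler_wpM2l (expR_ge0 _) (uniform_mean_expR_abs S t01)) _.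
rewrite mulrCA -expRD Sk ler_pM2l// ler_expR le_eqVlt; apply/orP; left; apply/eqP.
by field.
Qed.

Lemma scan_test_null n m k (tau : R) :
  (0 < k)%N -> (0 < m)%N -> 0 < tau <= 2^-1 ->
  prod_prob (@null_pmf R mu n) (scan_test n m k tau) <=
  'C(n, k)%:R * (2 * expR (- (tau ^+ 2 * k%:R / 4))) ^+ m.
Proof.
move=> k0 m0 t01; have t0 : 0 < tau by case/andP: t01.
apply: (@le_trans _ _ (prod_prob (@null_pmf R mu n) (fun s : samples n m =>
    [exists S : {set 'I_n}, (#|S| == k) && (tau <= phi_set k S s)]))).
  apply: le_prod_prob => [sigma|s]; first exact: (null_pmf_ge0 mu theta).
  rewrite /scan_test; apply: contraTT => /existsPn noS; rewrite -ltNge /phi3.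
  apply: bigmax_lt => // S Sk; have := noS S; rewrite Sk /= -ltNge//.
apply: le_trans (prod_prob_union _ _ _) _; first exact: (null_pmf_ge0 mu theta).
apply: (@le_trans _ _ (\sum_(S : {set 'I_n} | #|S| == k)
    (2 * expR (- (tau ^+ 2 * k%:R / 4))) ^+ m)).
  by apply: ler_sum => S /eqP Sk; exact: phi_set_null.
rewrite sumr_const -[X in _ *+ X]cardsE (card_draws 'I_n k) card_ord.
by rewrite -(mulr_natl (_ ^+ m)).
Qed.

(** From [k ^ k <= e ^ k * k!], a single term of the exponential series. *)
Lemma bin_le n k : (0 < k <= n)%N ->
  'C(n, k)%:R <= expR (k%:R * (1 + ln (n%:R / k%:R))) :> R.
Proof.
move=> /andP[k0 kn]; have kR : 0 < k%:R :> R by rewrite ltr0n.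
have nR : 0 < n%:R :> R by rewrite ltr0n (leq_trans k0).
have f0 : 0 < (k`!)%:R :> R by rewrite ltr0n fact_gt0.
rewrite expRM_natl expRD lnK ?posrE ?divr_gt0// exprMn -expRM_natl mulr1.
have bin1 : 'C(n, k)%:R * (k`!)%:R <= n%:R ^+ k :> R.
  rewrite -natrM bin_ffact -natrX ler_nat ffact_prod.
  rewrite -[X in (_ <= _ ^ X)%N]card_ord -prod_nat_const.
  by apply: leq_prod => i _; exact: leq_subr.
have fact1 : k%:R ^+ k <= expR k%:R * (k`!)%:R :> R.
  rewrite -ler_pdivrMr//; have := @expR_ge1Dxn R k%:R k.-1 (ltW kR).
  by rewrite prednK//; lra.
rewrite expr_div_n mulrA ler_pdivlMr ?exprn_gt0//.
have b0 : 0 <= 'C(n, k)%:R :> R by rewrite ler0n.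
apply: le_trans (ler_wpM2l b0 fact1) _.
by rewrite mulrCA ler_wpM2l ?expR_ge0.
Qed.

Variables (eps rho : R).
Hypothesis eps_gt0 : 0 < eps.
Hypothesis rho01 : 0 < rho < 1.
Hypothesis low_magnetization : forall n (S : {set 'I_n}), (0 < #|S|)%N ->
  \sum_(sigma | `|magnetization S sigma| <= eps * #|S|%:R)
     planted_pmf mu theta S sigma <= rho ^+ #|S|.

(** The statistic is at least [eps] times the proportion of the samples with a high
    magnetization on [S], so acceptance forces half of the samples to be low;
    Markov's inequality bounds this uniformly in [m]. *)
Lemma scan_test_planted n m (S : {set 'I_n}) (tau : R) :
  (0 < #|S|)%N -> (0 < m)%N -> tau <= eps / 2 ->
  prod_prob (planted_pmf mu theta S) (fun s => ~~ scan_test n m #|S| tau s) <=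
  2 * rho ^+ #|S|.
Proof.
move=> S0 m0 te; have kR : 0 < #|S|%:R :> R by rewrite ltr0n.
have mR : 0 < m%:R :> R by rewrite ltr0n.
pose low (sigma : config n) : R :=
  if `|magnetization S sigma| <= eps * #|S|%:R then 1 else 0.
have low0 sigma : 0 <= low sigma by rewrite /low; case: ifP.
apply: le_trans (prod_prob_markov (F := fun s =>
  2 * (m%:R^-1 * \sum_j low (tnth s j))) _ _ _) _.
- exact: planted_pmf_ge0.
- by move=> s; rewrite mulr_ge0// mulr_ge0 ?invr_ge0 ?(ltW mR)// sumr_ge0.
- move=> s; rewrite /scan_test -ltNge => small.
  have : phi_set #|S| S s < tau.
    by apply: le_lt_trans small; rewrite /phi3 (bigmaxD1 S)//= le_max lexx.
  rewrite /phi_set ltr_pdivrMl// => {}small.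
  rewrite mulrCA ler_pdivlMl// mulr1.
  set L := \sum_j low _.
  have : eps * (m%:R - L) <=
      \sum_j `|#|S|%:R^-1 * magnetization S (tnth s j)|.
    have -> : m%:R - L = \sum_(j < m) (1 - low (tnth s j)).
      by rewrite sumrB sumr_const card_ord.
    rewrite mulr_sumr; apply: ler_sum => j _; rewrite /low.
    case: (leP `|magnetization S _|) => [_|hi]; first by rewrite subrr mulr0.
    rewrite subr0 mulr1 normrM gtr0_norm ?invr_gt0// ler_pdivlMl// mulrC.
    exact: ltW.
  move=> /le_lt_trans /(_ small) lt1; have := ler_wpM2l (ltW mR) te => le2.
  have : eps * m%:R <= eps * (2 * L) by lra.
  by rewrite ler_pM2l.
rewrite sample_meanZ sample_mean_average//; last exact: sum_planted_pmf.
rewrite ler_pM2l//; apply: le_trans (low_magnetization S0).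
rewrite [leRHS]big_mkcond; apply: ler_sum => sigma _.
by rewrite /low; case: ifP; rewrite ?mulr1 ?mulr0.
Qed.

Lemma expR2_le16 : expR 2 <= 16 :> R.
Proof.
have h : 0 <= (2^-1 : R) <= 2^-1 by rewrite invr_ge0 lexx ler0n.
have e1 : expR 2^-1 <= 2 :> R.
  by apply: le_trans (expR_le_cubic_ge0 h) _; lra.
have -> : (2 : R) = 4%:R * 2^-1 by field.
rewrite expRM_natl (_ : (16 : R) = 2 ^+ 4); last by ring.
by rewrite lerXn2r ?nnegrE ?expR_ge0.
Qed.

(** The constant [16 / tau ^+ 2] makes the [m] samples pay twice the entropy
    [k * ln (n / k)] of the choice of [S]. *)
Lemma powerful_small_k (tau : R) : 0 < tau <= 2^-1 -> tau <= eps / 2 ->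
  forall n m : nat -> nat, (forall k, (k <= n k)%N) -> (forall k, (0 < m k)%N) ->
  (fun k => k%:R : R^o) =o_\oo (fun k => Num.sqrt (n k)%:R : R^o) ->
  (\forall k \near \oo, 16 / tau ^+ 2 * ln ((n k)%:R / k%:R) <= (m k)%:R) ->
  asymptotically_powerful mu theta (fun k => scan_test (n k) (m k) k tau).
Proof.
move=> tau01 te n m kn m0 ko mlarge; have t0 : 0 < tau by case/andP: tau01.
have t20 : 0 < tau ^+ 2 by rewrite exprn_gt0.
have eN1 : 0 < expR (- 1 : R) < 1 by rewrite expR_gt0 -[ltRHS]expR0 ltr_expR ltrN10.
apply: asymptotically_powerfulP => // e e0.
have e20 : 0 < e / 2 by rewrite divr_gt0.
have c0 : 0 < tau ^+ 2 / 8 by rewrite divr_gt0.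
near=> k; have k0 : (0 < k)%N by near: k; exact: nbhs_infty_gt.
have kR : 0 < k%:R :> R by rewrite ltr0n.
have mR : 0 < (m k)%:R :> R by rewrite ltr0n.
have kkn : (0 < k <= n k)%N by rewrite k0 kn.
split; last first.
  move=> S Sk; have S0 : (0 < #|S|)%N by rewrite Sk.
  have := scan_test_planted S0 (m0 k) te; rewrite Sk => /le_trans; apply.
  rewrite mulrC -ler_pdivlMr//; near: k; exact: near_expr_le.
have ln2 : 2 <= expR (tau ^+ 2 * k%:R / 8).
  have : k%:R^-1 <= tau ^+ 2 / 8 by near: k; exact: near_invr_le.
  rewrite -[k%:R^-1]mul1r ler_pdivrMr// => h1.
  by apply: le_trans (expR_ge1Dx _); lra.
have : 16 / tau ^+ 2 * ln ((n k)%:R / k%:R) <= (m k)%:R by near: k; exact: mlarge.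
set L : R := ln _ => mL.
have nk0 : 0 < (n k)%:R / k%:R :> R by rewrite divr_gt0// ltr0n (leq_trans k0).
have L2 : 2 <= L.
  have : `|k%:R : R^o| <= 4^-1 * `|Num.sqrt (n k)%:R : R^o|.
    by near: k; move/eqoP: ko; apply; rewrite invr_gt0.
  rewrite !ger0_norm ?sqrtr_ge0 ?(ltW kR)// => h.
  have k1 : 1 <= k%:R :> R by rewrite ler1n.
  have n16 : 16 * k%:R <= (n k)%:R :> R.
    rewrite -(sqr_sqrtr (ler0n R (n k))); set s := Num.sqrt _ in h *.
    have h4 : 4 * k%:R <= s by lra.
    have : (4 * k%:R) ^+ 2 <= s ^+ 2 by rewrite lerXn2r ?nnegrE ?mulr_ge0 ?sqrtr_ge0// ltW.
    apply: le_trans; rewrite exprMn (_ : 4 ^+ 2 = 16); last by ring.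
    by rewrite ler_pM2l// expr2 ler_pMr.
  rewrite -ler_expR lnK ?posrE//; apply: le_trans expR2_le16 _.
  by rewrite ler_pdivlMr.
have mL2 : 2 * L <= (m k)%:R * (tau ^+ 2 / 8).
  rewrite -ler_pdivrMr//; apply: le_trans mL; rewrite le_eqVlt; apply/orP; left.
  by apply/eqP; field; rewrite gt_eqF.
apply: le_trans (scan_test_null (n k) k0 (m0 k) tau01) _.
have per_sample : 2 * expR (- (tau ^+ 2 * k%:R / 4)) <= expR (- (tau ^+ 2 * k%:R / 8)).
  rewrite (_ : - (tau ^+ 2 * k%:R / 8) =
    tau ^+ 2 * k%:R / 8 - tau ^+ 2 * k%:R / 4); last by field.
  by rewrite [leRHS]expRD ler_wpM2r ?expR_ge0.
apply: (@le_trans _ _ (expR (k%:R * (1 + L)) * expR ((m k)%:R * - (tau ^+ 2 * k%:R / 8)))).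
  apply: ler_pM; rewrite ?ler0n ?exprn_ge0 ?mulr_ge0 ?expR_ge0//; first exact: bin_le.
  by rewrite expRM_natl lerXn2r ?nnegrE ?mulr_ge0 ?expR_ge0.
apply: (@le_trans _ _ (expR (-1) ^+ k)); last first.
  by near: k; exact: near_expr_le.
rewrite -expRD -expRM_natl ler_expR.
rewrite (_ : k%:R * _ + _ = k%:R * (1 + L - (m k)%:R * (tau ^+ 2 / 8))); last by field.
by rewrite ler_pM2l//; lra.
Unshelve. all: by end_near. Qed.

End ScanTest.

(** * The low temperature test *)

Unset Implicit Arguments.

Theorem theorem3p4 (R : realType) (mu : probability (measurableTypeR R) R)
    (theta1 x : R)
    (theta1_gt0 : 0 < theta1)
    (mean_tanh : \int[mu]_h tanh h = 0)
    (low_temperature : 1 / (\int[mu]_h (sech h ^+ 2)) < theta1)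
    (x_gt0 : 0 < x)
    (x_fixpoint : x = \int[mu]_h tanh (theta1 * x + h)) :
  [/\ (* k = o(sqrt n), m >= C log (n / k) *)
      exists2 tau : R, 0 < tau < x &
      exists2 C : R, 0 < C &
      forall n m : nat -> nat,
        (forall k, (k <= n k)%N) -> (forall k, (0 < m k)%N) ->
        (fun k => k%:R : R^o) =o_\oo (fun k => Num.sqrt (n k)%:R : R^o) ->
        (\forall k \near \oo, C * ln ((n k)%:R / k%:R) <= (m k)%:R) ->
        asymptotically_powerful mu theta1
          (fun k => scan_test (n k) (m k) k tau),
      (* k of order sqrt n, m = omega(1) *)
      exists2 tau : nat -> nat -> R,
        (forall n k, (0 < k <= n)%N ->
           tau_lower n k < tau n k < tau_upper x n k) &
      forall n m : nat -> nat,
        (forall k, (k <= n k)%N) -> (forall k, (0 < m k)%N) ->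
        (fun k => k%:R : R^o) =Theta_\oo (fun k => Num.sqrt (n k)%:R : R^o) ->
        (fun=> 1 : R^o) =o_\oo (fun k => (m k)%:R : R^o) ->
        asymptotically_powerful mu theta1
          (fun k => sum_test (n k) (m k) k (tau (n k) k))
    & (* k = omega(sqrt n), m = 1 *)
      exists2 tau : R, 0 < tau < x &
      forall n : nat -> nat,
        (forall k, (k <= n k)%N) ->
        (fun k => Num.sqrt (n k)%:R : R^o) =o_\oo (fun k => k%:R : R^o) ->
        asymptotically_powerful mu theta1
          (fun k => sum_test (n k) 1 k tau)].
Proof.
have [eps eps0 [rho rho01 low]] :=
  planted_low_magnetization theta1_gt0 mean_tanh low_temperature.
split.
- pose tau : R := Num.min (Num.min 2^-1 (eps / 2)) (x / 2).
  have tau0 : 0 < tau by rewrite !lt_min invr_gt0 ltr0n !divr_gt0.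
  have tau_half : tau <= 2^-1 by rewrite !ge_min lexx.
  have tau_eps : tau <= eps / 2 by rewrite !ge_min lexx orbT.
  have tau_x : tau <= x / 2 by rewrite ge_min lexx orbT.
  exists tau; first by apply/andP; split => //; lra.
  exists (16 / tau ^+ 2); first by rewrite divr_gt0// exprn_gt0.
  by apply: (powerful_small_k mean_tanh eps0 rho01 low) => //; rewrite tau0.
- exists (critical_threshold eps x).
    by move=> n k; exact: critical_threshold_itv.
  exact: (powerful_critical mean_tanh eps0 rho01 low x_gt0).
- pose tau : R := Num.min (eps / 2) (x / 2).
  have tau0 : 0 < tau by rewrite lt_min !divr_gt0.
  have tau_eps : tau <= eps / 2 by rewrite ge_min lexx.
  have tau_x : tau <= x / 2 by rewrite ge_min lexx orbT.
  exists tau; first by apply/andP; split => //; lra.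
  move=> n _; apply: (powerful_large_k mean_tanh eps0 rho01 low).
  by rewrite tau0.
Qed.
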